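(* There is a polynomial-time algorithm that, given an undirected graph $G$ on $n$ nodes with nonnegative weights on its edges, and a positive integer $k\le n$, constructs a tree in $G$ spanning at least $k$ nodes of weight at most $2\sqrt{k}$ times that of a minimum-weight tree spanning any $k$ nodes.
   Context: The weight of a tree is the sum of the weights of its edges. ''A minimum-weight tree spanning any $k$ nodes'' means a tree (subgraph of $G$) of minimum weight among all trees in $G$ spanning $k$ nodes, over all choices of the $k$ nodes. *)

(* Defs.v *)
From HB Require Import structures.
From mathcomp Require Import all_boot all_order all_algebra.
From mathcomp Require Import reals.

Set Implicit Arguments.
Unset Strict Implicit.
Unset Printing Implicit Defensive.

(* Model of computation: WHILE programs over binary trees (N. D. Jones,
   "Computability and Complexity from a Programming Perspective", 1997), with
   natural numbers instead of a single atom at the leaves.  Costs are bit costs: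
   evaluating an expression is charged, at every node of the expression, the
   full bit size of the value computed at that node (so reading a variable or
   building a pair is charged the size of the whole tree).  Up to a polynomial,
   this is Turing machine time. *)

Inductive data : Type :=
| Num of nat
| Pair of data & data.

Definition nil_data : data := Num 0.

Definition bits (m : nat) : nat := (trunc_log 2 m).+1.

Fixpoint dsize (d : data) : nat :=
  match d with
  | Num m => bits m
  | Pair a b => (dsize a + dsize b).+1
  end.

Definition num_of (d : data) : nat := if d is Num m then m else 0.
Definition hd_of (d : data) : data := if d is Pair a _ then a else nil_data.
Definition tl_of (d : data) : data := if d is Pair _ b then b else nil_data.
Definition is_pair (d : data) : bool := if d is Pair _ _ then true else false.
Definition truthy (d : data) : bool := if d is Num 0 then false else true.

Inductive expr : Type :=
| Var of nat
| Lit of nat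
| Cons of expr & expr
| Hd of expr
| Tl of expr
| IsPair of expr
| Add of expr & expr
| Sub of expr & expr
| Mul of expr & expr
| Leq of expr & expr.

Inductive cmd : Type :=
| Skip
| Assign of nat & expr
| Seq of cmd & cmd
| If of expr & cmd & cmd
| While of expr & cmd.

Definition store : Type := nat -> data.

Definition update (s : store) (x : nat) (d : data) : store :=
  fun y => if y == x then d else s y.

(* Arithmetic reads a pair as 0, and Sub is truncated subtraction. *)
Fixpoint eval (s : store) (e : expr) : data :=
  match e with
  | Var x => s x
  | Lit m => Num m
  | Cons e1 e2 => Pair (eval s e1) (eval s e2)
  | Hd e1 => hd_of (eval s e1)
  | Tl e1 => tl_of (eval s e1)
  | IsPair e1 => Num (is_pair (eval s e1))
  | Add e1 e2 => Num (num_of (eval s e1) + num_of (eval s e2))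
  | Sub e1 e2 => Num (num_of (eval s e1) - num_of (eval s e2))
  | Mul e1 e2 => Num (num_of (eval s e1) * num_of (eval s e2))
  | Leq e1 e2 => Num (num_of (eval s e1) <= num_of (eval s e2))
  end.

Fixpoint ecost (s : store) (e : expr) : nat :=
  dsize (eval s e) +
  match e with
  | Var _ | Lit _ => 0
  | Hd e1 | Tl e1 | IsPair e1 => ecost s e1
  | Cons e1 e2 | Add e1 e2 | Sub e1 e2 | Mul e1 e2 | Leq e1 e2 =>
      ecost s e1 + ecost s e2
  end.

(* [exec c s s' t]: from store [s], [c] halts in store [s'] after time [t]. *)
Inductive exec : cmd -> store -> store -> nat -> Prop :=
| exec_skip s : exec Skip s s 1
| exec_assign s x e :
    exec (Assign x e) s (update s x (eval s e)) (ecost s e).+1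
| exec_seq c1 c2 s s1 s2 t1 t2 :
    exec c1 s s1 t1 -> exec c2 s1 s2 t2 -> exec (Seq c1 c2) s s2 (t1 + t2)
| exec_if_true e c1 c2 s s' t :
    truthy (eval s e) -> exec c1 s s' t ->
    exec (If e c1 c2) s s' (ecost s e + t)
| exec_if_false e c1 c2 s s' t :
    ~~ truthy (eval s e) -> exec c2 s s' t ->
    exec (If e c1 c2) s s' (ecost s e + t)
| exec_while_stop e c s :
    ~~ truthy (eval s e) -> exec (While e c) s s (ecost s e)
| exec_while_step e c s s1 s2 t1 t2 :
    truthy (eval s e) -> exec c s s1 t1 -> exec (While e c) s1 s2 t2 ->
    exec (While e c) s s2 (ecost s e + t1 + t2).

Lemma exec_det c s s1 s2 t1 t2 :
  exec c s s1 t1 -> exec c s s2 t2 -> s1 = s2 /\ t1 = t2.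
Proof.
move=> H; elim: H s2 t2 => {c s s1 t1}.
- by move=> s s2 t2 H; inversion H.
- by move=> s x e s2 t2 H; inversion H.
- move=> c1 c2 s s1 s2 t1 t2 _ IH1 _ IH2 s3 t3 H.
  inversion H as [| | ? ? ? u1 ? v1 v2 E1 E2 | | | |]; subst.
  by case: (IH1 _ _ E1) => ? ?; subst; case: (IH2 _ _ E2) => ? ?; subst.
- move=> e c1 c2 s s' t b _ IH s3 t3 H.
  inversion H as [| | | ? ? ? ? ? ? nb E | ? ? ? ? ? ? nb E | |]; subst.
    by case: (IH _ _ E) => ? ?; subst.
  by rewrite b in nb.
- move=> e c1 c2 s s' t b _ IH s3 t3 H.
  inversion H as [| | | ? ? ? ? ? ? nb E | ? ? ? ? ? ? nb E | |]; subst.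
    by rewrite nb in b.
  by case: (IH _ _ E) => ? ?; subst.
- move=> e c s b s3 t3 H.
  inversion H as [| | | | | | ? ? ? ? ? ? ? nb]; subst => //.
  by rewrite nb in b.
- move=> e c s s1 s2 t1 t2 b _ IH1 _ IH2 s3 t3 H.
  inversion H as [| | | | | ? ? ? nb | ? ? ? ? ? ? ? nb E1 E2]; subst.
    by rewrite b in nb.
  by case: (IH1 _ _ E1) => ? ?; subst; case: (IH2 _ _ E2) => ? ?; subst.
Qed.

(* Input and output are in variable 0; all other variables start as nil. *)
Definition init_store (input : data) : store :=
  fun x => if x == 0 then input else nil_data.

Definition runs (p : cmd) (input output : data) (t : nat) : Prop :=
  exists2 s : store, exec p (init_store input) s t & s 0 = output.

(* Only the weights of the members of [edges] are meaningful. *)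
Record wgraph (n : nat) : Type := WGraph {
  edges : {set {set 'I_n}};
  weight : {set 'I_n} -> rat;
  edges_card2 : forall e, e \in edges -> #|e| = 2;
  weight_ge0 : forall e, e \in edges -> (0 <= weight e)%R
}.

Definition adj (n : nat) (F : {set {set 'I_n}}) : rel 'I_n :=
  fun u v => [set u; v] \in F.

Definition connected_on (n : nat) (V : {set 'I_n}) (F : {set {set 'I_n}}) :=
  forall u v, u \in V -> v \in V -> connect (adj F) u v.

(* A closed walk u, v along one edge is a [ucycle] of size 2, hence the bound. *)
Definition acyclic (n : nat) (F : {set {set 'I_n}}) : Prop :=
  forall c : seq 'I_n, ucycle (adj F) c -> size c < 3.

(* (V, F): node set and edge set of a subgraph of G. *)
Definition is_tree_in (n : nat) (G : wgraph n)
    (V : {set 'I_n}) (F : {set {set 'I_n}}) : Prop :=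
  [/\ F \subset edges G, (forall e, e \in F -> e \subset V), V != set0,
      connected_on V F & acyclic F].

Definition tree_weight (n : nat) (G : wgraph n) (F : {set {set 'I_n}}) : rat :=
  (\sum_(e in F) weight G e)%R.

Definition is_min_tree (n : nat) (G : wgraph n) (k : nat)
    (V : {set 'I_n}) (F : {set {set 'I_n}}) : Prop :=
  [/\ is_tree_in G V F, #|V| = k &
      forall (V' : {set 'I_n}) (F' : {set {set 'I_n}}),
        is_tree_in G V' F' -> #|V'| = k ->
        (tree_weight G F <= tree_weight G F')%R].

Definition enc_seq (T : Type) (enc : T -> data) (s : seq T) : data :=
  foldr (fun x d => Pair (enc x) d) nil_data s.

(* For nonnegative rationals only: the sign is dropped. *)
Definition enc_rat (q : rat) : data := Pair (Num `|numq q|) (Num `|denq q|).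

Definition enc_entry (n : nat) (G : wgraph n) (i j : 'I_n) : data :=
  if [set i; j] \in edges G then enc_rat (weight G [set i; j]) else nil_data.

Definition enc_instance (n : nat) (G : wgraph n) (k : nat) : data :=
  Pair (Num n) (Pair (Num k)
    (enc_seq (fun i => enc_seq (enc_entry G i) (enum 'I_n)) (enum 'I_n))).

Definition enc_node (n : nat) (i : 'I_n) : data := Num i.

Definition enc_edge (n : nat) (e : 'I_n * 'I_n) : data :=
  Pair (enc_node e.1) (enc_node e.2).

(* [d] is a list of the nodes in V paired with a list of the edges in F, each
   edge given by its two ends. *)
Definition represents (n : nat) (d : data)
    (V : {set 'I_n}) (F : {set {set 'I_n}}) : Prop :=
  exists (vs : seq 'I_n) (es : seq ('I_n * 'I_n)),
    [/\ d = Pair (enc_seq (@enc_node n) vs) (enc_seq (@enc_edge n) es),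
        V = [set v in vs] &
        F = [set:: [seq [set e.1; e.2] | e <- es]]].

(* Main.v *)
Require Import Defs.
From mathcomp Require Import all_boot all_order all_algebra.
From mathcomp Require Import reals.
From mathcomp Require Import zify.
Import Order.TTheory GRing.Theory Num.Theory.

Set Implicit Arguments.
Unset Strict Implicit.
Unset Printing Implicit Defensive.

(** Fix a root [v], a threshold [th] and a radius [D].  Grow a tree from [v] along edges of weight
    at most [th] as long as possible.  Whenever this gets stuck below [k] nodes, pick, among the
    nodes within distance [D] of [v] and outside the tree, one whose component in the graph of
    edges of weight at most [th] is largest, attach it by a shortest path from [v], and resume
    growing.  Output the cheapest tree found over all [v], [th] and [D].

    Let [L] be the optimal weight, [v] a node of an optimal tree, [th] the largest edge weight
    (or 0) with [th^2 k <= L^2], and [D] the largest distance from [v] that is at most [L].  The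
    optimal tree has [m] edges heavier than [th], with [m^2 <= k], so it meets at most [m + 1]
    components, and an exchange argument shows that [m] shortest paths suffice.  The tree costs
    at most [(k - 1) th + m L <= 2 sqrt k L].

    For the running time, the functions computed by polynomial-time programs are closed under
    composition, pairing, conditionals, and folds over lists whose accumulator stays polynomially
    bounded; the algorithm is written with these operations only.  Rational weights are first
    multiplied by the product of all denominators. *)

(** * Polynomially bounded functions and polynomial-time programs *)

(** Two obstacles shape the proof. For the running time, iterating a polynomial-time step can blow
    sizes up exponentially, so a fold needs a size bound on every intermediate accumulator. Almost
    every loop is therefore arranged so that one step adds a number of bits bounded by the fixed
    data alone: loops are clocked by the list of nodes, and distances are capped by a number [S].

    For the approximation, neither [L] nor an optimal tree is known, so [th] and [D] range over the
    edge weights and the computed distances, which are polynomially many values, and one good choice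
    suffices. If [c] is the least weight above [th] in the optimal tree, maximality of [th] gives
    [L^2 < c^2 k]; together with [m c <= L] this forces [m^2 <= k]. The choice of [th] also gives
    [th k <= sqrt k L], so the light edges and the shortest paths cost at most [sqrt k L] each,
    whence the factor 2. These inequalities are kept squared so as to stay within the natural
    numbers. *)

Definition is_poly (g : nat -> nat) : Prop := exists q : {poly nat}, g =1 horner q.

Lemma is_poly_const c : is_poly (fun _ => c).
Proof. by exists (polyC c) => x; rewrite hornerC. Qed.

Lemma is_poly_id : is_poly id.
Proof. by exists (polyX _) => x; rewrite hornerX. Qed.

Lemma is_poly_add g h : is_poly g -> is_poly h -> is_poly (fun x => g x + h x).
Proof. by move=> [p Hp] [q Hq]; exists (GRing.add p q) => x; rewrite hornerD Hp Hq. Qed.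

Lemma is_poly_mul g h : is_poly g -> is_poly h -> is_poly (fun x => g x * h x).
Proof. by move=> [p Hp] [q Hq]; exists (GRing.mul p q) => x; rewrite hornerM Hp Hq. Qed.

Lemma is_poly_comp g h : is_poly g -> is_poly h -> is_poly (fun x => g (h x)).
Proof. by move=> [p Hp] [q Hq]; exists (comp_poly q p) => x; rewrite horner_comp Hp Hq. Qed.

(** The coefficients are natural numbers, so every such polynomial is monotone; size bounds can thus
    be composed. *)
Lemma is_poly_mono g x y : is_poly g -> x <= y -> g x <= g y.
Proof.
move=> [q Hq] xy; rewrite !Hq; elim/poly_ind: q {g Hq} => [|p c IH].
  by rewrite !horner0.
by rewrite !hornerMXaddC leq_add2r; apply: leq_mul.
Qed.

(** * Encodings and bit sizes *)

Class Enc (T : Type) := enc : T -> data.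
#[export] Hint Mode Enc ! : typeclass_instances.
#[export] Instance Enc_nat : Enc nat := Defs.Num.
#[export] Instance Enc_bool : Enc bool := fun b => Defs.Num b.
#[export] Instance Enc_prod A B `{Enc A} `{Enc B} : Enc (A * B) :=
  fun z => Pair (enc z.1) (enc z.2).
#[export] Instance Enc_seq A `{Enc A} : Enc (seq A) := enc_seq enc.
(** No tag is added, in agreement with [enc_entry]. The two cases can be told apart when the codes
    of [A] are pairs, as for the entries of the input matrix. *)
#[export] Instance Enc_option A `{Enc A} : Enc (option A) :=
  fun o => if o is Some a then enc a else nil_data.

Definition esize {T} `{Enc T} (a : T) : nat := dsize (enc a).

Lemma bits_gt0 m : 0 < bits m. Proof. by []. Qed.

Lemma dsize_gt0 d : 0 < dsize d. Proof. by case: d. Qed.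

Lemma esize_gt0 T `{Enc T} (a : T) : 0 < esize a. Proof. exact: dsize_gt0. Qed.

Lemma bits_lt m : m < 2 ^ bits m.
Proof. exact: trunc_log_ltn. Qed.

Lemma bits_le m b : 0 < b -> m < 2 ^ b -> bits m <= b.
Proof.
case: b => // b _ H; rewrite /bits ltnS; case: m H => [|m] H.
  by rewrite trunc_log0.
rewrite -ltnS -(ltn_exp2l _ _ (isT : 1 < 2)).
by apply: leq_ltn_trans H; apply: trunc_logP.
Qed.

Lemma leq_bits m n : m <= n -> bits m <= bits n.
Proof. by move=> mn; apply: bits_le => //; apply: leq_ltn_trans mn (bits_lt n). Qed.

(** For powers of two [x, y >= 2] one has [x + y <= x * y]. Subadditivity lets a running sum grow by
    at most the bits of each summand. *)
Lemma bits_add m n : bits (m + n) <= bits m + bits n.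
Proof.
apply: bits_le; first by rewrite addn_gt0.
have [Hm Hn] := (bits_lt m, bits_lt n); rewrite expnD.
have: 2 <= 2 ^ bits m by rewrite -{1}(expn1 2) leq_exp2l.
have: 2 <= 2 ^ bits n by rewrite -{1}(expn1 2) leq_exp2l.
nia.
Qed.

Lemma bits_mul m n : bits (m * n) <= bits m + bits n.
Proof.
apply: bits_le; first by rewrite addn_gt0.
have [Hm Hn] := (bits_lt m, bits_lt n); rewrite expnD; nia.
Qed.

Definition poly_bounded {A} `{Enc A} (g : A -> nat) : Prop :=
  exists2 h, is_poly h & forall a, g a <= h (esize a).

Section poly_bounded.
Context (A : Type) `{Enc A}.

Lemma poly_bounded_le (g g' : A -> nat) : poly_bounded g -> (forall a, g' a <= g a) ->
  poly_bounded g'.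
Proof. by move=> [h ph gh] le; exists h => // a; apply: leq_trans (le a) (gh a). Qed.

Lemma poly_bounded_const c : poly_bounded (fun _ : A => c).
Proof. by exists (fun _ => c) => //; apply: is_poly_const. Qed.

Lemma poly_bounded_esize : poly_bounded (@esize A _).
Proof. by exists id => //; apply: is_poly_id. Qed.

Lemma poly_bounded_add (g g' : A -> nat) : poly_bounded g -> poly_bounded g' ->
  poly_bounded (fun a => g a + g' a).
Proof.
move=> [h ph gh] [h' ph' gh']; exists (fun x => h x + h' x); first exact: is_poly_add.
by move=> a; apply: leq_add.
Qed.

Lemma poly_bounded_mul (g g' : A -> nat) : poly_bounded g -> poly_bounded g' ->
  poly_bounded (fun a => g a * g' a).
Proof.
move=> [h ph gh] [h' ph' gh']; exists (fun x => h x * h' x); first exact: is_poly_mul.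
by move=> a; apply: leq_mul.
Qed.

Lemma poly_bounded_comp (B : Type) `{Enc B} (f : A -> B) (g : B -> nat) :
  poly_bounded (fun a => esize (f a)) -> poly_bounded g -> poly_bounded (fun a => g (f a)).
Proof.
move=> [h ph gh] [h' ph' gh']; exists (fun x => h' (h x)); first exact: is_poly_comp.
by move=> a; apply: leq_trans (gh' _) (is_poly_mono ph' (gh a)).
Qed.

End poly_bounded.
Arguments poly_bounded_esize {A H}.

(* The program reads and writes variable 0, may leave anything in the variables below [N], does
   not assume them initialised, and leaves the others unchanged, which makes programs composable. *)
Definition computes {A B} `{Enc A} `{Enc B} (f : A -> B) (p : cmd) (N : nat)
    (g : A -> nat) : Prop :=
  forall s a, s 0 = enc a ->
  exists s' t, [/\ exec p s s' t, s' 0 = enc (f a),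
    forall x, N <= x -> s' x = s x & t <= g a].

Definition polytime {A B} `{Enc A} `{Enc B} (f : A -> B) : Prop :=
  exists p N g, [/\ 0 < N, poly_bounded g & computes f p N g].

Lemma computes_weaken A B `{Enc A} `{Enc B} (f : A -> B) p N N' g :
  N <= N' -> computes f p N g -> computes f p N' g.
Proof.
move=> NN' C s a sa; have [s' [t [E o fr tb]]] := C s a sa.
by exists s', t; split=> // x /(leq_trans NN'); apply: fr.
Qed.

Lemma ecost_ge s e : dsize (eval s e) <= ecost s e.
Proof. by case: e => *; rewrite /= leq_addr. Qed.

(** An assignment is charged the size of the value it writes, so elapsed time bounds the growth of
    every variable. Outputs of polynomial-time programs therefore have polynomial size, as
    composition requires. *)
Lemma exec_dsize p s s' t : exec p s s' t -> forall x, dsize (s' x) <= dsize (s x) + t.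
Proof.
elim=> {p s s' t}.
- by move=> s x; rewrite leq_addr.
- move=> s x e y; rewrite /update; case: eqP => [->|_]; last by rewrite leq_addr.
  by have := ecost_ge s e; lia.
- by move=> c1 c2 s s1 s2 t1 t2 _ I1 _ I2 x; move: (I1 x) (I2 x); lia.
- by move=> e c1 c2 s s' t _ _ I x; have := I x; lia.
- by move=> e c1 c2 s s' t _ _ I x; have := I x; lia.
- by move=> e c s _ x; lia.
- by move=> e c s s1 s2 t1 t2 _ _ I1 _ I2 x; move: (I1 x) (I2 x); lia.
Qed.

Lemma polytime_esize A B `{Enc A} `{Enc B} (f : A -> B) : polytime f ->
  poly_bounded (fun a => esize (f a)).
Proof.
move=> [p [N [g [_ Pg C]]]]; apply: (poly_bounded_le (poly_bounded_add poly_bounded_esize Pg)) => a.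
have [s' [t [E o _ tb]]] := C (fun _ => enc a) a erefl.
by have := exec_dsize E 0; rewrite o /esize; lia.
Qed.

Lemma polytime_ext A B `{Enc A} `{Enc B} (f f' : A -> B) : f =1 f' -> polytime f -> polytime f'.
Proof.
move=> ff' [p [N [g [N0 Pg C]]]]; exists p, N, g; split=> // s a sa.
by rewrite -ff'; apply: C.
Qed.

Lemma polytime_id A `{Enc A} : polytime (fun a : A => a).
Proof.
exists Skip, 1, (fun _ => 1); split=> //; first exact: poly_bounded_const.
by move=> s a sa; exists s, 1; split=> //; constructor.
Qed.

Lemma polytime_comp A B C `{Enc A} `{Enc B} `{Enc C} (f : A -> B) (g : B -> C) :
  polytime g -> polytime f -> polytime (fun a => g (f a)).
Proof.
move=> [p [N [b [N0 Pb Cp]]]] Pf; have Pdf := polytime_esize Pf.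
case: Pf => [p' [N' [b' [N0' Pb' Cp']]]].
exists (Seq p' p), (maxn N N'), (fun a => b' a + b (f a)); split.
- by rewrite leq_max N0.
- exact: poly_bounded_add Pb' (poly_bounded_comp Pdf Pb).
move=> s a /Cp'[s1 [t1 [E1 /Cp[s2 [t2 [E2 o2 fr2 l2]]] fr1 l1]]].
exists s2, (t1 + t2); split=> //; first exact: exec_seq E1 E2.
  by move=> x; rewrite geq_max => /andP[Nx N'x]; rewrite fr2 // fr1.
exact: leq_add.
Qed.

Lemma dsize_hd d : dsize (hd_of d) <= dsize d.
Proof. by case: d => //= a b; lia. Qed.

Lemma dsize_tl d : dsize (tl_of d) <= dsize d.
Proof. by case: d => //= a b; lia. Qed.

Lemma bits_num d : bits (num_of d) <= dsize d.
Proof. by case: d. Qed.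

Lemma bits_bool (b : bool) : bits b = 1. Proof. by case: b. Qed.

Lemma esize_bool (b : bool) : dsize (enc b) = 1. Proof. exact: bits_bool. Qed.

Fixpoint only0 (e : expr) : bool :=
  match e with
  | Var x => x == 0
  | Lit _ => true
  | Hd e1 | Tl e1 | IsPair e1 => only0 e1
  | Defs.Cons e1 e2 | Add e1 e2 | Defs.Sub e1 e2 | Mul e1 e2 | Leq e1 e2 =>
      only0 e1 && only0 e2
  end.

(** Each operator, multiplication included, yields a value of size at most the sum of the sizes of
    its arguments plus one; the expression being fixed, the bounds add up to a polynomial. *)
Lemma eval_bound e : only0 e ->
  exists2 h, is_poly h & forall s, dsize (eval s e) <= h (dsize (s 0)).
Proof.
have bin e1 e2 (R : data -> data -> data) :
    (forall a b, dsize (R a b) <= (dsize a + dsize b).+1) ->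
    (exists2 h, is_poly h & forall s, dsize (eval s e1) <= h (dsize (s 0))) ->
    (exists2 h, is_poly h & forall s, dsize (eval s e2) <= h (dsize (s 0))) ->
    exists2 h, is_poly h & forall s, dsize (R (eval s e1) (eval s e2)) <= h (dsize (s 0)).
  move=> HR [h1 p1 H1] [h2 p2 H2]; exists (fun x => h1 x + h2 x + 1).
    by apply: is_poly_add; [exact: is_poly_add|exact: is_poly_const].
  by move=> s; move: (HR (eval s e1) (eval s e2)) (H1 s) (H2 s); lia.
elim: e => /= [x /eqP->|m _|e1 I1 e2 I2|e1 I1|e1 I1|e1 I1|e1 I1 e2 I2|e1 I1 e2 I2|e1 I1 e2 I2|e1
  I1 e2 I2].
- by exists id => //; apply: is_poly_id.
- by exists (fun _ => bits m); first exact: is_poly_const.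
- by case/andP=> /I1 ? /I2 ?; apply: bin Pair _ _ _ => //=.
- by move=> /I1[h ph H]; exists h => // s; apply: leq_trans (dsize_hd _) (H s).
- by move=> /I1[h ph H]; exists h => // s; apply: leq_trans (dsize_tl _) (H s).
- by move=> _; exists (fun _ => 1) => [|s]; [exact: is_poly_const|rewrite bits_bool].
- case/andP=> /I1 ? /I2 ?; apply: (bin e1 e2 (fun a b => Defs.Num (num_of a + num_of b))) => // a
  b /=.
  by move: (bits_add (num_of a) (num_of b)) (bits_num a) (bits_num b); lia.
- case/andP=> /I1 ? /I2 ?; apply: (bin e1 e2 (fun a b => Defs.Num (num_of a - num_of b))) => // a
  b /=.
  by move: (leq_bits (leq_subr (num_of b) (num_of a))) (bits_num a); lia.
- case/andP=> /I1 ? /I2 ?; apply: (bin e1 e2 (fun a b => Defs.Num (num_of a * num_of b))) => // a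
  b /=.
  by move: (bits_mul (num_of a) (num_of b)) (bits_num a) (bits_num b); lia.
- case/andP=> /I1 ? /I2 ?; apply: (bin e1 e2 (fun a b => Defs.Num (num_of a <=
  num_of b))) => // a b /=.
  by rewrite bits_bool; lia.
Qed.

Lemma ecost_bound e : only0 e ->
  exists2 h, is_poly h & forall s, ecost s e <= h (dsize (s 0)).
Proof.
have add (f g : store -> nat) :
    (exists2 h, is_poly h & forall s, f s <= h (dsize (s 0))) ->
    (exists2 h, is_poly h & forall s, g s <= h (dsize (s 0))) ->
    exists2 h, is_poly h & forall s, f s + g s <= h (dsize (s 0)).
  move=> [h1 p1 H1] [h2 p2 H2]; exists (fun x => h1 x + h2 x); first exact: is_poly_add.
  by move=> s; apply: leq_add.
elim: e => [x|m|e1 I1 e2 I2|e1 I1|e1 I1|e1 I1|e1 I1 e2 I2|e1 I1 e2 I2|e1 I1 e2 I2|e1 I1 e2 I2] o;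
  apply: (add _ _ (eval_bound o)); rewrite /= in o *;
  try by [exists (fun _ => 0); [exact: is_poly_const|]
         | case/andP: o => /I1 ? /I2 ?; apply: add | apply: I1].
Qed.

Lemma polytime_expr A B `{Enc A} `{Enc B} (f : A -> B) (e : expr) : only0 e ->
  (forall s a, s 0 = enc a -> eval s e = enc (f a)) -> polytime f.
Proof.
move=> o ev; have [h ph hb] := ecost_bound o.
exists (Assign 0 e), 1, (fun a => h (esize a) + 1); split=> //.
  apply: poly_bounded_add (poly_bounded_const _); by exists h.
move=> s a sa; exists (update s 0 (eval s e)), (ecost s e).+1; split.
- exact: exec_assign.
- by rewrite /update eqxx (ev s a).
- by case.
- by rewrite addn1 ltnS /esize -sa.
Qed.

Fixpoint lit (d : data) : expr :=
  match d with Defs.Num m => Lit m | Pair a b => Defs.Cons (lit a) (lit b) end.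

Lemma polytime_const A B `{Enc A} `{Enc B} (b : B) : polytime (fun _ : A => b).
Proof.
apply: (@polytime_expr _ _ _ _ _ (lit (enc b))); first by elim: (enc b) => //= ? -> ? ->.
by move=> s _ _; elim: (enc b) => //= ? -> ? ->.
Qed.

Lemma polytime_pair A B C `{Enc A} `{Enc B} `{Enc C} (f : A -> B) (g : A -> C) :
  polytime f -> polytime g -> polytime (fun a => (f a, g a)).
Proof.
move=> Pf Pg; have [Pdf Pdg] := (polytime_esize Pf, polytime_esize Pg).
case: Pf Pg => [p1 [N1 [b1 [N10 Pb1 Cp1]]]] [p2 [N2 [b2 [N20 Pb2 Cp2]]]].
(* Variables [N] and [N.+1] lie beyond the scratch space of both programs; they save the input and
   the first result. *)
pose N := maxn N1 N2.
have {}Cp1 : computes f p1 N b1 by apply: computes_weaken Cp1; rewrite leq_maxl.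
have {}Cp2 : computes g p2 N b2 by apply: computes_weaken Cp2; rewrite leq_maxr.
have N0 : 0 < N by rewrite leq_max N10.
exists (Seq (Assign N (Var 0)) (Seq p1 (Seq (Assign N.+1 (Var 0))
  (Seq (Assign 0 (Var N)) (Seq p2 (Assign 0 (Defs.Cons (Var N.+1) (Var 0)))))))), N.+2,
  (fun a => (esize a) * 2 + (b1 a + b2 a + (esize (f a) + esize (f a) + esize (f a) + esize (g a)
    + esize (g a) + 5))).
split=> //.
  by do ?[apply: poly_bounded_add|apply: poly_bounded_mul|apply: poly_bounded_const|apply:
    poly_bounded_esize|exact].
move=> s a sa.
pose s0 := update s N (s 0).
have [|s1 [t1 [E1 o1 fr1 l1]]] := Cp1 s0 a.
  by rewrite /s0 /update (ltn_eqF N0).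
pose s2 := update s1 N.+1 (s1 0); pose s3 := update s2 0 (s2 N).
have s2N : s2 N = enc a.
  by rewrite /s2 /update (ltn_eqF (ltnSn N)) fr1 // /s0 /update eqxx.
have [|s4 [t4 [E4 o4 fr4 l4]]] := Cp2 s3 a.
  by rewrite /s3 /update eqxx.
have s4N : s4 N.+1 = enc (f a).
  by rewrite fr4 // /s3 /update /= /s2 /update eqxx.
eexists; eexists; split.
- apply: exec_seq; first exact: exec_assign.
  apply: exec_seq; first exact: E1.
  apply: exec_seq; first exact: exec_assign.
  apply: exec_seq; first exact: exec_assign.
  apply: exec_seq; first exact: E4.
  exact: exec_assign.
- by rewrite /update /= s4N o4.
- move=> x Nx; rewrite /update; have x0 : x == 0 = false by lia.
  rewrite x0 fr4; last by lia.
  rewrite /s3 /update x0 /s2 /update; have -> : x == N.+1 = false by lia.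
  rewrite fr1; last by lia.
  by rewrite /s0 /update; have -> : x == N = false by lia.
- rewrite /= -/s2 s2N s4N o4 o1 sa /esize /=.
  move: (dsize _) (dsize _) (dsize _) => u v w; lia.
Qed.

Lemma polytime_if A B `{Enc A} `{Enc B} (c : A -> bool) (f g : A -> B) :
  polytime c -> polytime f -> polytime g -> polytime (fun a => if c a then f a else g a).
Proof.
move=> [p0 [N0 [b0 [N00 Pb0 Cp0]]]] [p1 [N1 [b1 [N10 Pb1 Cp1]]]] [p2 [N2 [b2 [N20 Pb2 Cp2]]]].
pose N := maxn N0 (maxn N1 N2).
have {}Cp0 : computes c p0 N b0 by apply: computes_weaken Cp0; rewrite /N; lia.
have {}Cp1 : computes f p1 N b1 by apply: computes_weaken Cp1; rewrite /N; lia.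
have {}Cp2 : computes g p2 N b2 by apply: computes_weaken Cp2; rewrite /N; lia.
have N_0 : 0 < N by rewrite /N; lia.
exists (Seq (Assign N (Var 0)) (Seq p0 (Seq (Assign N.+1 (Var 0))
  (Seq (Assign 0 (Var N)) (If (Var N.+1) p1 p2))))), N.+2,
  (fun a => (esize a) * 2 + (b0 a + b1 a + b2 a + 5)).
split=> //.
  by do ?[apply: poly_bounded_add|apply: poly_bounded_mul|apply: poly_bounded_const|apply:
    poly_bounded_esize|exact].
move=> s a sa.
pose s0 := update s N (s 0).
have [|s1 [t1 [E1 o1 fr1 l1]]] := Cp0 s0 a.
  by rewrite /s0 /update (ltn_eqF N_0).
pose s2 := update s1 N.+1 (s1 0); pose s3 := update s2 0 (s2 N).
have s2N : s2 N = enc a.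
  by rewrite /s2 /update (ltn_eqF (ltnSn N)) fr1 // /s0 /update eqxx.
have s30 : s3 0 = enc a by rewrite /s3 /update eqxx.
have s3N : s3 N.+1 = enc (c a) by rewrite /s3 /update /= /s2 /update eqxx.
have [s4 [t4 [E4 o4 fr4 l4]]] : exists s' t, [/\ exec (If (Var N.+1) p1 p2) s3 s' t,
    s' 0 = enc (if c a then f a else g a), forall x, N <= x -> s' x = s3 x &
    t <= b1 a + b2 a + 1].
  case ca: (c a) in s3N *.
  - have [s4 [t4 [E4 o4 fr4 l4]]] := Cp1 s3 a s30.
    exists s4, (ecost s3 (Var N.+1) + t4); split=> //; first by apply: exec_if_true;
      rewrite //= s3N.
    by rewrite /= s3N esize_bool; lia.
  - have [s4 [t4 [E4 o4 fr4 l4]]] := Cp2 s3 a s30.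
    exists s4, (ecost s3 (Var N.+1) + t4); split=> //; first by apply: exec_if_false;
      rewrite //= s3N.
    by rewrite /= s3N esize_bool; lia.
eexists; eexists; split.
- apply: exec_seq; first exact: exec_assign.
  apply: exec_seq; first exact: E1.
  apply: exec_seq; first exact: exec_assign.
  apply: exec_seq; first exact: exec_assign.
  exact: E4.
- exact: o4.
- move=> x Nx; have x0 : x == 0 = false by lia.
  rewrite fr4; last by lia.
  rewrite /s3 /update x0 /s2 /update; have -> : x == N.+1 = false by lia.
  rewrite fr1; last by lia.
  by rewrite /s0 /update; have -> : x == N = false by lia.
- rewrite /= -/s2 s2N o1 sa /esize /= bits_bool.
  move: (dsize _) => u; lia.
Qed.

(** * Loops over lists *)

Lemma esize_pair A B `{Enc A} `{Enc B} (a : A) (b : B) : esize (a, b) = (esize a + esize b).+1.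
Proof. by []. Qed.

Lemma esize_cons A `{Enc A} (y : A) l : esize (y :: l) = (esize y + esize l).+1.
Proof. by []. Qed.

Lemma enc_cons A `{Enc A} (y : A) l : enc (y :: l) = Pair (enc y) (enc l).
Proof. by []. Qed.

Lemma update_eq s x d : update s x d x = d. Proof. by rewrite /update eqxx. Qed.

Lemma update_neq s x d y : y != x -> update s x d y = s y.
Proof. by rewrite /update => /negPf->. Qed.

(** Variable [N] holds the context, [N.+1] the rest of the list and [N.+2] the accumulator, all
    beyond the scratch space of [p]. *)
Definition fold_body (N : nat) (p : cmd) : cmd :=
  Seq (Assign 0 (Defs.Cons (Var N) (Defs.Cons (Var N.+2) (Hd (Var N.+1)))))
    (Seq p (Seq (Assign N.+2 (Var 0)) (Assign N.+1 (Tl (Var N.+1))))).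

(** The bound [G] is demanded only of the accumulators that actually occur, those of the prefixes of
    [l]: a bound on one application of [f] would not control its iterates. *)
Lemma exec_fold A B C `{Enc A} `{Enc B} `{Enc C} (f : A -> B -> C -> B)
    (p : cmd) (N : nat) (tb : A * (B * C) -> nat) (h : nat -> nat) (x : A)
    (G M : nat) (l : seq C) (b : B) (s : store) :
  0 < N -> computes (fun z => f z.1 z.2.1 z.2.2) p N tb ->
  is_poly h -> (forall z, tb z <= h (esize z)) ->
  s N = enc x -> s N.+1 = enc l -> s N.+2 = enc b ->
  (forall l1 l2, l = l1 ++ l2 -> esize (foldl (f x) b l1) <= G) -> esize l <= M ->
  exists s' t, [/\ exec (While (IsPair (Var N.+1)) (fold_body N p)) s s' t,
    s' N.+2 = enc (foldl (f x) b l), forall y, N.+3 <= y -> s' y = s y &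
    t <= (size l).+1 * (h (esize x + G + M + 2) + 10 * (esize x + G + M + 2))].
Proof.
move=> N0 Cp ph hb; set K := (X in _ * X).
elim: l b s => [|y l IH] b s sN sN1 sN2 GB ML.
  exists s, (ecost s (IsPair (Var N.+1))); split=> //.
    by apply: exec_while_stop; rewrite /= sN1.
  rewrite /= sN1 /= /K /bits trunc_log0; lia.
have bG : esize b <= G by apply: (GB [::] (y :: l)).
have yM : (esize y + esize l).+1 <= M by [].
pose (s1 := update s 0 (Pair (enc x) (Pair (enc b) (enc y)))).
have [|s2 [t2 [E2 o2 fr2 l2]]] := Cp s1 (x, (b, y)); first by rewrite /s1 update_eq.
rewrite /= in o2.
pose s3 := update s2 N.+2 (s2 0).
pose s4 := update s3 N.+1 (tl_of (s3 N.+1)).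
have s3N1 : s3 N.+1 = enc (y :: l).
  by rewrite /s3 update_neq ?fr2 /s1 ?update_neq //; lia.
have s4N : s4 N = enc x.
  by rewrite /s4 update_neq /s3 ?update_neq ?fr2 /s1 ?update_neq //; lia.
have [|||||s5 [t5 [E5 o5 fr5 l5]]] := IH (f x b y) s4.
- exact: s4N.
- by rewrite /s4 update_eq s3N1.
- by rewrite /s4 update_neq ?/s3 ?update_eq //; lia.
- by move=> l1 l2' e; apply: (GB (y :: l1) l2'); rewrite e.
- by apply: leq_trans yM; lia.
have eG : dsize (enc (f x b y)) <= G by apply: (GB [:: y] l).
have ev : eval s (Defs.Cons (Var N) (Defs.Cons (Var N.+2) (Hd (Var N.+1)))) =
  Pair (enc x) (Pair (enc b) (enc y)).
  by rewrite /= sN sN1 sN2.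
exists s5; eexists; split.
- apply: exec_while_step; [by rewrite /= sN1| |exact: E5].
  apply: exec_seq; first exact: exec_assign.
  rewrite ev -/s1; apply: exec_seq; first exact: E2.
  by apply: exec_seq; exact: exec_assign.
- exact: o5.
- move=> z zN; rewrite fr5 // /s4 update_neq /s3 ?update_neq ?fr2 /s1 ?update_neq //; lia.
- rewrite -/s3 /= s3N1 sN sN1 sN2 o2 enc_cons /=.
  have -> : bits 1 = 1 by [].
  have := hb (x, (b, y)); rewrite !esize_pair => hb'.
  have hK : h (esize x + (esize b + esize y).+1).+1 <= h (esize x + G + M + 2).
    by apply: is_poly_mono => //; lia.
  have [dy dl] : dsize (enc y) = esize y /\ dsize (enc l) = esize l by [].
  have [db dx] : dsize (enc b) = esize b /\ dsize (enc x) = esize x by [].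
  rewrite dy dl db dx mulSn; move: l5; set Z := (_ .+1 * K) => l5.
  move: l2 hb' hK eG bG yM; have KE : K = h (esize x + G + M + 2) + 10 * (esize x + G + M + 2) by
    []; lia.
Qed.

Lemma size_esize A `{Enc A} (l : seq A) : size l < esize l.
Proof.
elim: l => [|y l IH]; first by rewrite esize_gt0.
by rewrite esize_cons /=; have := esize_gt0 y; lia.
Qed.

Lemma polytime_foldl A B C `{Enc A} `{Enc B} `{Enc C} (f : A -> B -> C -> B)
    (l : A -> seq C) (b : A -> B) (g : A -> nat) :
  polytime (fun z : A * (B * C) => f z.1 z.2.1 z.2.2) -> polytime l -> polytime b ->
    poly_bounded g ->
  (forall x l1 l2, l x = l1 ++ l2 -> esize (foldl (f x) (b x) l1) <= g x) ->
  polytime (fun x => foldl (f x) (b x) (l x)).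
Proof.
move=> [p0 [N0 [b0 [N00 [h ph hb] Cp0]]]] Pl Pb Pg gb.
have [Pdl Pdb] := (polytime_esize Pl, polytime_esize Pb).
case: Pl Pb => [p1 [N1 [b1 [N10 Pb1 Cp1]]]] [p2 [N2 [b2 [N20 Pb2 Cp2]]]].
pose N := maxn N0 (maxn N1 N2).
have {}Cp0 := @computes_weaken _ _ _ _ _ _ _ N _ (leq_maxl _ _) Cp0.
have {}Cp1 : computes l p1 N b1 by apply: computes_weaken Cp1; rewrite /N; lia.
have {}Cp2 : computes b p2 N b2 by apply: computes_weaken Cp2; rewrite /N; lia.
have N_0 : 0 < N by rewrite /N; lia.
exists (Seq (Assign N (Var 0)) (Seq p1 (Seq (Assign N.+1 (Var 0))
  (Seq (Assign 0 (Var N)) (Seq p2 (Seq (Assign N.+2 (Var 0))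
  (Seq (While (IsPair (Var N.+1)) (fold_body N p0)) (Assign 0 (Var N.+2))))))))), N.+3,
  (fun a => (esize a) * 2 + b1 a + esize (l a) + b2 a + esize (b a) + g a + 5 +
    (esize (l a)) * (h (esize a + g a + esize (l a) + 2) + 10 * (esize a + g a + esize (l a) + 2))).
split=> //.
  have Ph : poly_bounded (fun a => h (esize a + g a + esize (l a) + 2)).
    have [k pk kb] : poly_bounded (fun a => esize a + g a + esize (l a) + 2).
      by do ?[apply: poly_bounded_add|apply: poly_bounded_mul|apply: poly_bounded_const|apply:
        poly_bounded_esize|exact].
    exists (fun x => h (k x)); first exact: is_poly_comp.
    by move=> a; apply: is_poly_mono.
  by do ?[apply: poly_bounded_add|apply: poly_bounded_mul|apply: poly_bounded_const|apply:
    poly_bounded_esize|exact].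
move=> s a sa.
pose s0 := update s N (s 0).
have [|s1 [t1 [E1 o1 fr1 l1]]] := Cp1 s0 a.
  by rewrite /s0 update_neq //; lia.
pose s2 := update s1 N.+1 (s1 0); pose s3 := update s2 0 (s2 N).
have s2N : s2 N = enc a.
  by rewrite /s2 update_neq ?fr1 // /s0 ?update_eq //; lia.
have [|s4 [t4 [E4 o4 fr4 l4]]] := Cp2 s3 a.
  by rewrite /s3 update_eq.
pose s5 := update s4 N.+2 (s4 0).
have [|||s6 [t6 [E6 o6 fr6 l6]]] := exec_fold (s := s5) (l := l a) (b :=
  b a) N_0 Cp0 ph hb _ _ _ (@gb a) (leqnn _).
- by rewrite /s5 update_neq ?fr4 // /s3 ?update_neq //; lia.
- by rewrite /s5 update_neq ?fr4 /s3 ?update_neq /s2 ?update_eq //; lia.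
- by rewrite /s5 update_eq.
eexists; eexists; split.
- apply: exec_seq; first exact: exec_assign.
  apply: exec_seq; first exact: E1.
  apply: exec_seq; first exact: exec_assign.
  apply: exec_seq; first exact: exec_assign.
  apply: exec_seq; first exact: E4.
  apply: exec_seq; first exact: exec_assign.
  apply: exec_seq; first exact: E6.
  exact: exec_assign.
- by rewrite update_eq /= o6.
- move=> x Nx; rewrite update_neq ?fr6 /s5 ?update_neq ?fr4 /s3 ?update_neq /s2 ?update_neq ?fr1
  /s0 ?update_neq //; lia.
- have lG : dsize (enc (foldl (f a) (b a) (l a))) <= g a.
    by apply: (gb a (l a) [::]); rewrite cats0.
  pose proof (size_esize (l a)) as sz.
  have {}l6 := leq_trans l6 (leq_mul sz (leqnn _)).
  rewrite /= -/s2 s2N o1 o4 o6 sa.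
  have [dl da] : dsize (enc (l a)) = esize (l a) /\ dsize (enc a) = esize a by [].
  have db : dsize (enc (b a)) = esize (b a) by [].
  rewrite dl da db; move: l6; set Z := _ * (_ + _) => l6.
  lia.
Qed.

(** * Arithmetic and lists *)

Lemma polytime_fst A B C `{Enc A} `{Enc B} `{Enc C} (f : A -> B * C) :
  polytime f -> polytime (fun a => (f a).1).
Proof.
by apply: polytime_comp; apply: (@polytime_expr _ _ _ _ _ (Hd (Var 0))) => // s [a b] /= ->.
Qed.

Lemma polytime_snd A B C `{Enc A} `{Enc B} `{Enc C} (f : A -> B * C) :
  polytime f -> polytime (fun a => (f a).2).
Proof.
by apply: polytime_comp; apply: (@polytime_expr _ _ _ _ _ (Tl (Var 0))) => // s [a b] /= ->.
Qed.

Lemma polytime_comp2 A B C D `{Enc A} `{Enc B} `{Enc C} `{Enc D} (F : B -> C -> D) (f : A ->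
  B) (g : A -> C) :
  polytime (fun z : B * C => F z.1 z.2) -> polytime f -> polytime g ->
    polytime (fun a => F (f a) (g a)).
Proof. by move=> PF Pf Pg; apply: (polytime_comp PF (polytime_pair Pf Pg)). Qed.

Section Arith.
Context (A : Type) `{Enc A}.
Implicit Types f g : A -> nat.

Lemma polytime_addn f g : polytime f -> polytime g -> polytime (fun a => f a + g a).
Proof.
apply: (polytime_comp2 (F := addn)).
by apply: (@polytime_expr _ _ _ _ _ (Add (Hd (Var 0)) (Tl (Var 0)))) => // s [a b] /= ->.
Qed.

Lemma polytime_subn f g : polytime f -> polytime g -> polytime (fun a => f a - g a).
Proof.
apply: (polytime_comp2 (F := subn)).
by apply: (@polytime_expr _ _ _ _ _ (Defs.Sub (Hd (Var 0)) (Tl (Var 0)))) => // s [a b] /= ->.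
Qed.

Lemma polytime_muln f g : polytime f -> polytime g -> polytime (fun a => f a * g a).
Proof.
apply: (polytime_comp2 (F := muln)).
by apply: (@polytime_expr _ _ _ _ _ (Mul (Hd (Var 0)) (Tl (Var 0)))) => // s [a b] /= ->.
Qed.

Lemma polytime_leq f g : polytime f -> polytime g -> polytime (fun a => f a <= g a).
Proof.
apply: (polytime_comp2 (F := leq)).
by apply: (@polytime_expr _ _ _ _ _ (Leq (Hd (Var 0)) (Tl (Var 0)))) => // s [a b] /= ->.
Qed.

Lemma polytime_S f : polytime f -> polytime (fun a => (f a).+1).
Proof. exact: (@polytime_addn (fun _ => 1) f (polytime_const 1)). Qed.

Lemma polytime_and (b c : A -> bool) : polytime b -> polytime c -> polytime (fun a => b a && c a).
Proof. by move=> Pb Pc; apply: polytime_if => //; apply: polytime_const. Qed.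

Lemma polytime_or (b c : A -> bool) : polytime b -> polytime c -> polytime (fun a => b a || c a).
Proof. by move=> Pb Pc; apply: polytime_if => //; apply: polytime_const. Qed.

Lemma polytime_not (b : A -> bool) : polytime b -> polytime (fun a => ~~ b a).
Proof. by move=> Pb; apply: polytime_if => //; apply: polytime_const. Qed.

Lemma polytime_eqn f g : polytime f -> polytime g -> polytime (fun a => f a == g a).
Proof.
move=> Pf Pg; apply: (@polytime_ext _ _ _ _ (fun a => (f a <= g a) && (g a <= f a))).
  by move=> a; rewrite -eqn_leq.
by apply: polytime_and; apply: polytime_leq.
Qed.

End Arith.

Lemma polytime_cons A B `{Enc A} `{Enc B} (f : A -> B) (l : A -> seq B) :
  polytime f -> polytime l -> polytime (fun a => f a :: l a).
Proof.
apply: (polytime_comp2 (F := cons)).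
(* A pair [(y, l)] and the list [y :: l] have the same code, so the identity suffices. *)
by apply: (@polytime_expr _ _ _ _ _ (Var 0)) => // s [a b] /= ->.
Qed.

Lemma polytime_nilp A B `{Enc A} `{Enc B} (l : A -> seq B) :
  polytime l -> polytime (fun a => nilp (l a)).
Proof.
move=> Pl; apply: (polytime_comp (f := l)) (Pl).
apply: (@polytime_ext _ _ _ _ (fun l : seq B => ~~ ~~ nilp l)); first by move=> ?; rewrite negbK.
apply: polytime_not.
by apply: (@polytime_expr _ _ _ _ _ (IsPair (Var 0))) => // s [|a b] /= ->.
Qed.

Lemma esize_cat A `{Enc A} (l1 l2 : seq A) : esize (l1 ++ l2) < esize l1 + esize l2.
Proof. by elim: l1 => [//|y l IH]; rewrite cat_cons !esize_cons; lia. Qed.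

Lemma esize_catl A `{Enc A} (l1 l2 : seq A) : esize l1 <= esize (l1 ++ l2).
Proof. by elim: l1 => [|y l IH]; rewrite ?esize_gt0 // cat_cons !esize_cons; lia. Qed.

Lemma esize_mem (A : eqType) `{Enc A} (l : seq A) y : y \in l -> esize y < esize l.
Proof.
elim: l => [//|z l IH]; rewrite inE esize_cons => /orP[/eqP->|/IH]; lia.
Qed.

Lemma esize_foldl B C `{Enc B} `{Enc C} (f : B -> C -> B) (b : B) (l : seq C) (M g : nat) :
  (forall b y, esize y <= M -> esize (f b y) <= esize b + g) -> esize l <= M ->
  esize (foldl f b l) <= esize b + size l * g.
Proof.
move=> Hf; elim: l b => [|y l IH] b; first by rewrite addn0.
rewrite esize_cons => lM; have {}IH := IH (f b y) (ltac:(lia)).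
by apply: leq_trans IH _; have := Hf b y (ltac:(lia)); rewrite /= mulSn; lia.
Qed.

(** The form in which loops are normally handled: the increment [g x] depends on the context and not
    on the accumulator, so sizes grow linearly in the number of steps. *)
Lemma polytime_foldl_add A B C `{Enc A} `{Enc B} `{Enc C} (f : A -> B -> C -> B)
    (l : A -> seq C) (b : A -> B) (g : A -> nat) :
  polytime (fun z : A * (B * C) => f z.1 z.2.1 z.2.2) -> polytime l -> polytime b ->
    poly_bounded g ->
  (forall x b y, esize y <= esize (l x) -> esize (f x b y) <= esize b + g x) ->
  polytime (fun x => foldl (f x) (b x) (l x)).
Proof.
move=> Pf Pl Pb Pg Hg.
apply: (@polytime_foldl _ _ _ _ _ _ _ _ _ (fun x => esize (b x) + esize (l x) * g x)) => //.
  by apply: poly_bounded_add; [exact: polytime_esize|apply: poly_bounded_mul => //;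
    exact: polytime_esize].
move=> x l1 l2 E; have l1l : esize l1 <= esize (l x) by rewrite E esize_catl.
apply: leq_trans (esize_foldl _ (Hg x) l1l) _.
by rewrite leq_add2l leq_mul2r; apply/orP; right; apply: leq_trans l1l; apply/ltnW/size_esize.
Qed.

(** Turns a bound in the context and a list element into one in the context alone, as needed for the
    increment of a fold. *)
Lemma poly_bounded_sup A B C `{Enc A} `{Enc B} `{Enc C} (G : A * C -> nat) (l : A -> seq B) :
  poly_bounded G -> polytime l -> exists2 g, poly_bounded g & forall x y, esize y <=
    esize (l x) -> G (x, y) <= g x.
Proof.
move=> [h ph hG] Pl; exists (fun x => h (esize x + esize (l x) + 1)).
  have [k pk kb] : poly_bounded (fun x => esize x + esize (l x) + 1).
    by do ?apply: poly_bounded_add; [exact: poly_bounded_esize|exact: polytime_esize|exact: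
      poly_bounded_const].
  exists (fun x => h (k x)); first exact: is_poly_comp.
  by move=> a; apply: is_poly_mono.
move=> x y xy; apply: leq_trans (hG _) (is_poly_mono ph _).
by rewrite esize_pair; lia.
Qed.

Lemma polytime_rev A B `{Enc A} `{Enc B} (l : A -> seq B) : polytime l ->
  polytime (fun x => rev (l x)).
Proof.
move=> Pl; apply: (@polytime_ext _ _ _ _ (fun x => foldl (fun b y => y :: b) [::] (l x))).
  by move=> x; elim/last_ind: (l x) => // s y IH; rewrite foldl_rcons IH rev_rcons.
apply: (@polytime_foldl_add _ _ _ _ _ _ (fun x b y => y :: b) _ _ (fun x => esize (l x) + 1)) => //.
- by apply: polytime_cons; do ?apply: polytime_snd; do ?apply: polytime_fst;
  do ?apply: polytime_snd; apply: polytime_id.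
- exact: polytime_const.
- by apply: poly_bounded_add; [exact: polytime_esize|exact: poly_bounded_const].
- by move=> x b y yl; rewrite esize_cons; lia.
Qed.

Lemma polytime_map A B C `{Enc A} `{Enc B} `{Enc C} (f : A -> B -> C) (l : A -> seq B) :
  polytime (fun z : A * B => f z.1 z.2) -> polytime l -> polytime (fun x => map (f x) (l x)).
Proof.
move=> Pf Pl.
apply: (@polytime_ext _ _ _ _ (fun x => rev (foldl (fun b y => f x y :: b) [::] (l x)))).
  by move=> x; elim/last_ind: (l x) => // s y IH; rewrite foldl_rcons rev_cons IH map_rcons.
apply: polytime_rev.
have [g Pg Hg] := poly_bounded_sup (polytime_esize Pf) Pl.
apply: (@polytime_foldl_add _ _ _ _ _ _ (fun x b y => f x y :: b) _ _ (fun x => g x + 1)) => //.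
- apply: polytime_cons; last by apply: polytime_fst; apply: polytime_snd; apply: polytime_id.
  apply: (polytime_comp Pf (f := fun z : A * (seq C * B) => (z.1, z.2.2))).
  by apply: polytime_pair; [apply: polytime_fst|do ?apply: polytime_snd]; apply: polytime_id.
- exact: polytime_const.
- by apply: poly_bounded_add => //; exact: poly_bounded_const.
- by move=> x b y /Hg /=; rewrite esize_cons; lia.
Qed.

Lemma polytime_filter A B `{Enc A} `{Enc B} (p : A -> B -> bool) (l : A -> seq B) :
  polytime (fun z : A * B => p z.1 z.2) -> polytime l -> polytime (fun x => filter (p x) (l x)).
Proof.
move=> Pp Pl.
apply: (@polytime_ext _ _ _ _
  (fun x => rev (foldl (fun b y => if p x y then y :: b else b) [::] (l x)))).
  move=> x; elim/last_ind: (l x) => // s y IH.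
  by rewrite foldl_rcons filter_rcons -IH; case: ifP => // _; rewrite rev_cons.
apply: polytime_rev.
apply: (@polytime_foldl_add _ _ _ _ _ _ (fun x b y => if p x y then y :: b else b) _ _
  (fun x => esize (l x) + 1)) => //.
- have P1 : polytime (fun z : A * (seq B * B) => z.2.1) by apply: polytime_fst;
  apply: polytime_snd; apply: polytime_id.
  have P2 : polytime (fun z : A * (seq B * B) => z.2.2) by do ?apply: polytime_snd;
    apply: polytime_id.
  apply: polytime_if => //; last exact: polytime_cons.
  apply: (polytime_comp Pp (f := fun z : A * (seq B * B) => (z.1, z.2.2))).
  by apply: polytime_pair => //; apply: polytime_fst; apply: polytime_id.
- exact: polytime_const.
- by apply: poly_bounded_add; [exact: polytime_esize|exact: poly_bounded_const].
- by move=> x b y yl; case: ifP => _; rewrite ?esize_cons; lia.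
Qed.

Lemma polytime_flatten A B `{Enc A} `{Enc B} (l : A -> seq (seq B)) :
  polytime l -> polytime (fun x => flatten (l x)).
Proof.
move=> Pl.
have Pcat : polytime (fun z : seq B * seq B => z.1 ++ z.2).
  apply: (@polytime_ext _ _ _ _ (fun z : seq B * seq B => foldl (fun b y => y :: b) z.2 (rev z.1))).
    by move=> z; rewrite foldl_rev; elim: z.1 => //= a s ->.
  apply: (@polytime_foldl_add _ _ _ _ _ _ (fun x b y => y :: b) _ _
    (fun z : seq B * seq B => esize (rev z.1) + 1)).
  - by apply: polytime_cons; do ?apply: polytime_snd; do ?apply: polytime_fst;
    do ?apply: polytime_snd; apply: polytime_id.
  - by apply: polytime_rev; apply: polytime_fst; apply: polytime_id.
  - by apply: polytime_snd; apply: polytime_id.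
  - apply: poly_bounded_add; last exact: poly_bounded_const.
    by apply: polytime_esize; apply: polytime_rev; apply: polytime_fst; apply: polytime_id.
  - by move=> x b y yl; rewrite esize_cons; lia.
apply: (@polytime_ext _ _ _ _ (fun x => foldl (fun b y => y ++ b) [::] (rev (l x)))).
  by move=> x; rewrite foldl_rev; elim: (l x) => //= a s ->.
apply: (@polytime_foldl_add _ _ _ _ _ _ (fun x b y => y ++ b) _ _ (fun x => esize (rev (l x)))).
- apply: (polytime_comp Pcat (f := fun z : A * (seq B * seq B) => (z.2.2, z.2.1))).
  by apply: polytime_pair; do ?apply: polytime_snd; do ?apply: polytime_fst;
    do ?apply: polytime_snd; apply: polytime_id.
- exact: polytime_rev.
- exact: polytime_const.
- by apply: polytime_esize; apply: polytime_rev.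
- by move=> x b y yl; pose proof (esize_cat y b); lia.
Qed.

Lemma esize_bits (m : nat) : esize m = bits m. Proof. by []. Qed.

Lemma polytime_mem A `{Enc A} (f : A -> nat) (l : A -> seq nat) :
  polytime f -> polytime l -> polytime (fun x => f x \in l x).
Proof.
move=> Pf Pl.
apply: (@polytime_ext _ _ _ _ (fun x => foldl (fun b y => b || (f x == y)) false (l x))).
  move=> x; rewrite -[RHS]orFb; elim: (l x) false => [|y s IH] b /=; first by rewrite orbF.
  by rewrite IH inE orbA.
apply: (@polytime_foldl_add _ _ _ _ _ _ (fun x b y => b || (f x == y)) _ _ (fun x => 1)) => //.
- apply: polytime_or; first by apply: polytime_fst; apply: polytime_snd; apply: polytime_id.
  apply: polytime_eqn; last by do ?apply: polytime_snd; apply: polytime_id.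
  by apply: (polytime_comp Pf); apply: polytime_fst; apply: polytime_id.
- exact: polytime_const.
- exact: poly_bounded_const.
- by move=> x b y _; rewrite /esize !esize_bool.
Qed.

Lemma polytime_size A B `{Enc A} `{Enc B} (l : A -> seq B) : polytime l ->
  polytime (fun x => size (l x)).
Proof.
move=> Pl; apply: (@polytime_ext _ _ _ _ (fun x => foldl (fun b _ => b.+1) 0 (l x))).
  move=> x; rewrite -[RHS]addn0; elim: (l x) 0 => [|y s IH] b //=.
  by rewrite IH addSn addnS.
apply: (@polytime_foldl_add _ _ _ _ _ _ (fun x b y => b.+1) _ _ (fun x => 1)) => //.
- by apply: polytime_S; apply: polytime_fst; apply: polytime_snd; apply: polytime_id.
- exact: polytime_const.
- exact: poly_bounded_const.
- by move=> x b y _; rewrite !esize_bits -addn1; apply: bits_add.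
Qed.

Lemma polytime_isSome A B `{Enc A} `{Enc B} (o : A -> option (B * B)) :
  polytime o -> polytime (fun x => isSome (o x)).
Proof.
apply: (polytime_comp (f := o)).
by apply: (@polytime_expr _ _ _ _ _ (IsPair (Var 0))) => // s [a|] /= ->.
Qed.

Lemma polytime_option A `{Enc A} (o : A -> option (nat * nat)) :
  polytime o -> polytime (fun x => odflt (0, 0) (o x)).
Proof.
apply: (polytime_comp (f := o)).
(* On nil both [Hd] and [Tl] return nil, the code of 0, which produces the default [(0, 0)]. *)
by apply: (@polytime_expr _ _ _ _ _ (Defs.Cons (Hd (Var 0)) (Tl (Var 0)))) => // s [a|] /= ->.
Qed.

(** * The algorithm *)

(* An edge [(x, (y, w))] leads from [y] to [x] and has weight [w]; edge lists contain both
   orientations. A state consists of the nodes, the edges and the cost of a tree. *)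
Notation edge := (nat * (nat * nat))%type.
Notation state := (seq nat * (seq (nat * nat) * nat))%type.

Definition attach (s : state) (e : edge) : state :=
  (e.1 :: s.1, ((e.1, e.2.1) :: s.2.1, s.2.2 + e.2.2)).

Definition extend (s : state) (e : edge) : state :=
  if (e.2.1 \in s.1) && (e.1 \notin s.1) then attach s e else s.

Definition light_step (th cap : nat) (s : state) (e : edge) : state :=
  if (size s.1 < cap) && (e.2.2 <= th) then extend s e else s.

Definition light_pass (E : seq edge) (th cap : nat) (s : state) : state :=
  foldl (light_step th cap) s E.

(** The list [ns] only serves as a clock: a pass that is not stuck adds a node, so [size ns] passes
    are enough. *)
Definition light_grow (E : seq edge) (ns : seq nat) (th cap : nat) (s : state) : state :=
  foldl (fun s _ => light_pass E th cap s) s ns.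

Definition single (v : nat) : state := ([:: v], ([::], 0)).

Definition light_comp (E : seq edge) (ns : seq nat) (th u : nat) : seq nat :=
  (light_grow E ns th (size ns) (single u)).1.

Definition key B (l : seq (B * nat)) : nat := if l is c :: _ then c.2 else 0.

(* [argmin] returns a list of length at most one, empty only on the empty list. *)
Definition argmin B (l : seq (B * nat)) : seq (B * nat) :=
  foldl (fun b c => if nilp b || (c.2 < key b) then [:: c] else b) [::] l.

(* A list of entries [(e, d)], latest first: node [e.1] is at distance [d] from the root and was
   reached through edge [e] from its parent [e.2.1]. The root is its own parent, through a
   fictitious edge of weight 0 that [extend] never attaches. *)
Definition reached (T : seq (edge * nat)) : seq nat := [seq t.1.1 | t <- T].

(** The cap [S] bounds the size of a new entry independently of [T], which makes the growth per step
    additive. *)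
Definition dijkstra_cand (S : nat) (T : seq (edge * nat)) (e : edge) : seq (edge * nat) :=
  [seq (e, t.2 + e.2.2) | t <- T &
    [&& t.1.1 == e.2.1, e.1 \notin reached T & t.2 + e.2.2 <= S]].

Definition dijkstra_step (E : seq edge) (S : nat) (T : seq (edge * nat)) : seq (edge * nat) :=
  argmin (flatten [seq dijkstra_cand S T e | e <- E]) ++ T.

Definition dijkstra (E : seq edge) (ns : seq nat) (S v : nat) : seq (edge * nat) :=
  foldl (fun T _ => dijkstra_step E S T) [:: ((v, (v, 0)), 0)] ns.

(** Parents are entered before their children and so lie further along the list; one traversal
    recovers the whole path, listed from the root. *)
Definition path_step (st : nat * seq edge) (t : edge * nat) : nat * seq edge :=
  if t.1.1 == st.1 then (t.1.2.1, t.1 :: st.2) else st.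

Definition path_to (T : seq (edge * nat)) (u : nat) : seq edge :=
  (foldl path_step (u, [::]) T).2.

Definition walk (T : seq (edge * nat)) (s : state) (u : nat) : state :=
  foldl extend s (path_to T u).

(** Since [argmin] minimises, a largest component is selected through the complement of its size in
    [size ns]. *)
Definition targets (E : seq edge) (ns : seq nat) (th : nat) (T : seq (edge * nat)) (s : state) :
    seq (nat * nat) :=
  argmin [seq (u, size ns - size (light_comp E ns th u)) | u <- reached T & u \notin s.1].

(** The fold over a list of length at most one plays the role of a case analysis on whether a target
    exists; [solve] uses the same device. *)
Definition round (E : seq edge) (ns : seq nat) (th k : nat) (T : seq (edge * nat)) (s : state) :
    state :=
  if size s.1 < k then
    foldl (fun s c => light_grow E ns th k (walk T s c.1)) s (targets E ns th T s)
  else s.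

Definition run (E : seq edge) (ns : seq nat) (th k : nat) (T : seq (edge * nat)) (v : nat) :
    state :=
  foldl (fun s _ => round E ns th k T s) (light_grow E ns th k (single v)) ns.

Definition within (D : nat) (T : seq (edge * nat)) : seq (edge * nat) :=
  [seq t <- T | t.2 <= D].

Definition runs_from (E : seq edge) (ns : seq nat) (k v : nat) (T : seq (edge * nat)) : seq state :=
  flatten [seq [seq run E ns th k (within D T) v | th <- 0 :: [seq e.2.2 | e <- E]]
    | D <- [seq t.2 | t <- T]].

Definition candidates (E : seq edge) (ns : seq nat) (k S : nat) : seq state :=
  flatten [seq runs_from E ns k v (dijkstra E ns S v) | v <- ns].

Definition solve (E : seq edge) (ns : seq nat) (k S : nat) : seq nat * seq (nat * nat) :=
  foldl (fun _ c => (c.1.1, c.1.2.1)) ([::], [::])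
    (argmin [seq (s, s.2.2) | s <- candidates E ns k S & k <= size s.1]).

Ltac pt1 := lazymatch goal with
  | |- polytime (fun a => a) => apply: polytime_id
  | |- polytime (fun _ => ?b) => apply: polytime_const
  | |- polytime (fun a => fst (@?f0 a)) => apply: polytime_fst
  | |- polytime (fun a => snd (@?f0 a)) => apply: polytime_snd
  | |- polytime (fun a => addn (@?f0 a) (@?f1 a)) => apply: polytime_addn
  | |- polytime (fun a => subn (@?f0 a) (@?f1 a)) => apply: polytime_subn
  | |- polytime (fun a => muln (@?f0 a) (@?f1 a)) => apply: polytime_muln
  | |- polytime (fun a => leq (@?f0 a) (@?f1 a)) => apply: polytime_leq
  | |- polytime (fun a => eq_op (@?f0 a) (@?f1 a)) => apply: polytime_eqn
  | |- polytime (fun a => S (@?f0 a)) => apply: polytime_S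
  | |- polytime (fun a => andb (@?f0 a) (@?f1 a)) => apply: polytime_and
  | |- polytime (fun a => orb (@?f0 a) (@?f1 a)) => apply: polytime_or
  | |- polytime (fun a => negb (@?f0 a)) => apply: polytime_not
  | |- polytime (fun a => in_mem (@?f0 a) (@?f1 a)) => apply: polytime_mem
  | |- polytime (fun a => size (@?f0 a)) => apply: polytime_size
  | |- polytime (fun a => nilp (@?f0 a)) => apply: polytime_nilp
  | |- polytime (fun a => cons (@?f0 a) (@?f1 a)) => apply: polytime_cons
  | |- polytime (fun a => pair (@?f0 a) (@?f1 a)) => apply: polytime_pair
  | |- polytime fst => apply: (polytime_fst (@polytime_id _ _))
  | |- polytime snd => apply: (polytime_snd (@polytime_id _ _))
  | |- _ => assumption
  end.
Ltac pt := do ?pt1.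

Lemma polytime_comp3 X A B C D `{Enc X} `{Enc A} `{Enc B} `{Enc C} `{Enc D}
    (F : A -> B -> C -> D) (a : X -> A) (b : X -> B) (c : X -> C) :
  polytime (fun z : A * (B * C) => F z.1 z.2.1 z.2.2) -> polytime a -> polytime b -> polytime c ->
  polytime (fun x => F (a x) (b x) (c x)).
Proof. by move=> PF Pa Pb Pc; apply: (polytime_comp PF (polytime_pair Pa (polytime_pair Pb Pc))).
  Qed.

Lemma polytime_comp4 X A B C D G `{Enc X} `{Enc A} `{Enc B} `{Enc C} `{Enc D} `{Enc G}
    (F : A -> B -> C -> D -> G) (a : X -> A) (b : X -> B) (c : X -> C) (d : X -> D) :
  polytime (fun z : A * (B * (C * D)) => F z.1 z.2.1 z.2.2.1 z.2.2.2) ->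
  polytime a -> polytime b -> polytime c -> polytime d -> polytime (fun x => F (a x) (b x) (c x)
    (d x)).
Proof.
by move=> PF Pa Pb Pc Pd; apply: (polytime_comp PF (polytime_pair Pa (polytime_pair Pb
  (polytime_pair Pc Pd)))).
Qed.

Lemma polytime_comp5 X A B C D G I `{Enc X} `{Enc A} `{Enc B} `{Enc C} `{Enc D} `{Enc G} `{Enc I}
    (F : A -> B -> C -> D -> G -> I) (a : X -> A) (b : X -> B) (c : X -> C) (d : X ->
      D) (e : X -> G) :
  polytime (fun z : A * (B * (C * (D * G))) => F z.1 z.2.1 z.2.2.1 z.2.2.2.1 z.2.2.2.2) ->
  polytime a -> polytime b -> polytime c -> polytime d -> polytime e ->
    polytime (fun x => F (a x) (b x) (c x) (d x) (e x)).
Proof.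
move=> PF Pa Pb Pc Pd Pe.
by apply: (polytime_comp PF (polytime_pair Pa (polytime_pair Pb (polytime_pair Pc (polytime_pair
  Pd Pe))))).
Qed.

Lemma polytime_comp6 X A B C D G I J `{Enc X} `{Enc A} `{Enc B} `{Enc C} `{Enc D} `{Enc G} `{Enc
  I} `{Enc J}
    (F : A -> B -> C -> D -> G -> I -> J) (a : X -> A) (b : X -> B) (c : X -> C) (d : X -> D)
    (e : X -> G) (i : X -> I) :
  polytime (fun z : A * (B * (C * (D * (G * I)))) =>
    F z.1 z.2.1 z.2.2.1 z.2.2.2.1 z.2.2.2.2.1 z.2.2.2.2.2) ->
  polytime a -> polytime b -> polytime c -> polytime d -> polytime e -> polytime i ->
  polytime (fun x => F (a x) (b x) (c x) (d x) (e x) (i x)).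
Proof.
move=> PF Pa Pb Pc Pd Pe Pi.
by apply: (polytime_comp PF (polytime_pair Pa (polytime_pair Pb (polytime_pair Pc (polytime_pair
  Pd (polytime_pair Pe Pi)))))).
Qed.

Lemma polytime_attach : polytime (fun z : state * edge => attach z.1 z.2).
Proof. rewrite /attach; pt. Qed.

Lemma polytime_extend : polytime (fun z : state * edge => extend z.1 z.2).
Proof. rewrite /extend; apply polytime_if; last by pt. pt. exact: polytime_attach. Qed.

(** * Running time *)

Ltac pb := do ?first [ eassumption | apply: poly_bounded_const | apply: poly_bounded_add | apply:
  poly_bounded_mul
  | (apply: polytime_esize; solve [pt]) ].

(** The new node enters both the node list and the edge list, whence the factor 2; the cost grows by
    at most the bits of the weight. *)
Lemma esize_attach s e : esize (attach s e) <= esize s + (2 * esize e + 3).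
Proof.
case: s e => [V [F c]] [x [y w]]; rewrite /attach /= !esize_pair !esize_cons !esize_pair
  !esize_bits.
move: (bits_add c w) (bits_gt0 w); lia.
Qed.

Lemma esize_extend s e : esize (extend s e) <= esize s + (2 * esize e + 3).
Proof. by rewrite /extend; case: ifP => _; [exact: esize_attach|exact: leq_addr]. Qed.

Lemma esize_light_step th cap s e : esize (light_step th cap s e) <= esize s + (2 * esize e + 3).
Proof. by rewrite /light_step; case: ifP => _; [exact: esize_extend|exact: leq_addr]. Qed.

Lemma esize_extend_fold s (l : seq edge) : esize (foldl extend s l) <=
  esize s + size l * (2 * esize l + 3).
Proof.
apply: (@esize_foldl _ _ _ _ _ _ _ (esize l)) => // b y yl; apply: leq_trans (esize_extend b y) _;
  lia.
Qed.

Lemma esize_light_pass E th cap s : esize (light_pass E th cap s) <=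
  esize s + size E * (2 * esize E + 3).
Proof.
apply: (@esize_foldl _ _ _ _ _ _ _ (esize E)) => // b y yl; apply: leq_trans (esize_light_step _ _
  b y) _; lia.
Qed.

Lemma esize_light_grow E ns th cap s :
  esize (light_grow E ns th cap s) <= esize s + size ns * (size E * (2 * esize E + 3)).
Proof. by apply: (@esize_foldl _ _ _ _ _ _ _ (esize ns)) => // b y _; apply: esize_light_pass. Qed.

Lemma polytime_light_pass : polytime (fun z : seq edge * (nat * (nat * state)) => light_pass z.1
  z.2.1 z.2.2.1 z.2.2.2).
Proof.
apply: (@polytime_foldl_add _ _ _ _ _ _ (fun z => light_step z.2.1 z.2.2.1) _ _ (fun z => 2 *
  esize z.1 + 3)).
- rewrite /light_step /=; apply: polytime_if; pt.
  by apply: (polytime_comp2 (F := extend)); [exact: polytime_extend| |]; pt.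
- by pt.
- by pt.
- by pb.
- move=> z s e ze; apply: leq_trans (esize_light_step _ _ s e) _; lia.
Qed.

Lemma polytime_light_grow : polytime (fun z : seq edge * (seq nat * (nat * (nat * state))) =>
  light_grow z.1 z.2.1 z.2.2.1 z.2.2.2.1 z.2.2.2.2).
Proof.
apply: (@polytime_foldl_add _ _ _ _ _ _ (fun z s _ => light_pass z.1 z.2.2.1 z.2.2.2.1 s) _ _
  (fun z => size z.1 * (2 * esize z.1 + 3))); try by pt.
- by apply: (polytime_comp4 polytime_light_pass); pt.
- apply: (poly_bounded_le (g := fun z => esize z.1 * (2 * esize z.1 + 3))); first by pb.
  by move=> z; rewrite leq_mul2r (ltnW (size_esize _)) orbT.
- by move=> z s e _; apply: esize_light_pass.
Qed.

Lemma polytime_single X `{Enc X} (v : X -> nat) : polytime v -> polytime (fun x => single (v x)).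
Proof. by move=> Pv; rewrite /single; pt. Qed.

Lemma polytime_light_comp : polytime (fun z : seq edge * (seq nat * (nat * nat)) =>
  light_comp z.1 z.2.1 z.2.2.1 z.2.2.2).
Proof.
rewrite /light_comp; apply: polytime_fst; apply: (polytime_comp5 polytime_light_grow); pt.
by apply: polytime_single; pt.
Qed.

Section Argmin.
Context (B : Type) `{Enc B}.

(** Membership is expressed by splitting the list because [B] is an arbitrary type. *)
Lemma argminP (l : seq (B * nat)) :
  argmin l = [::] /\ l = [::] \/
  exists l1 c l2, [/\ argmin l = [:: c], l = l1 ++ c :: l2 &
    forall l1 d l2, l = l1 ++ d :: l2 -> c.2 <= d.2].
Proof.
elim/last_ind: l => [|l c IH]; [by left|right].
rewrite /argmin foldl_rcons -/(argmin l); case: IH => [[-> ->]|[l1 [b [l2 [-> E Hb]]]]] /=.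
  exists [::], c, [::]; split=> // [] [|? [|? ?]] d l2 //= [] // -> //.
case: ltnP => cb.
  exists l, c, [::]; split=> //; first by rewrite cats1.
  move=> l3 d; elim/last_ind => [|l4 d' _].
    by rewrite cats1 => /rcons_inj[_ ->].
  rewrite -rcons_cons -rcons_cat => /rcons_inj[/Hb bd _].
  exact: leq_trans (ltnW cb) bd.
exists l1, b, (rcons l2 c); split=> //.
  by rewrite E -rcons_cons -rcons_cat.
move=> l3 d; elim/last_ind => [|l4 d' _].
  by rewrite cats1 => /rcons_inj[_ <-].
by rewrite -rcons_cons -rcons_cat => /rcons_inj[/Hb].
Qed.

Lemma polytime_argmin X `{Enc X} (l : X -> seq (B * nat)) : polytime l ->
  polytime (fun x => argmin (l x)).
Proof.
move=> Pl.
apply: (@polytime_foldl_add _ _ _ _ _ _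
  (fun _ b c => if nilp b || (c.2 < key b) then [:: c] else b) _ _ (fun z => esize (l z) + 2)); pt.
- have Pk : polytime (fun l : seq (B * nat) => key l).
    (* On nil the expression evaluates to nil, which is the code of the default key 0. *)
    by apply: (@polytime_expr _ _ _ _ _ (Tl (Hd (Var 0)))) => // s [|[a n] b] /= ->.
  apply: polytime_if; pt; apply: (polytime_comp Pk); pt.
- by pb.
- move=> x b c cl; case: ifP => _; last by lia.
  by rewrite esize_cons; have : esize ([::] : seq (B * nat)) = 1 by []; lia.
Qed.

End Argmin.

Lemma polytime_cat X B `{Enc X} `{Enc B} (l1 l2 : X -> seq B) :
  polytime l1 -> polytime l2 -> polytime (fun x => l1 x ++ l2 x).
Proof.
move=> P1 P2; apply: (@polytime_ext _ _ _ _ (fun x => flatten [:: l1 x; l2 x])).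
  by move=> x; rewrite /= cats0.
by apply: polytime_flatten; pt.
Qed.

Lemma argmin_mem (B : eqType) (l : seq (B * nat)) c : c \in argmin l ->
  [/\ argmin l = [:: c], c \in l & forall d, d \in l -> c.2 <= d.2].
Proof.
case: (argminP l) => [[-> _] //|[l1 [c' [l2 [E1 E2 H]]]]].
rewrite E1 inE => /eqP->; split=> //; first by rewrite E2 mem_cat inE eqxx orbT.
by move=> d dl; case: (path.splitPr dl) H => l3 l4 H; exact: H erefl.
Qed.

Lemma argmin_nil (B : eqType) (l : seq (B * nat)) : argmin l = [::] -> l = [::].
Proof. by case: (argminP l) => [[]|[l1 [c [l2 [-> _]]]]]. Qed.

Lemma argmin_cons (B : eqType) (l : seq (B * nat)) d : d \in l -> exists c, argmin l = [:: c].
Proof.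
case: (argminP l) => [[_ ->] //|[l1 [c [l2 [E _ _]]]]] _; by exists c.
Qed.

Lemma polytime_reached X `{Enc X} (T : X -> seq (edge * nat)) : polytime T ->
  polytime (fun x => reached (T x)).
Proof. by move=> PT0; apply: polytime_map; pt. Qed.

Lemma polytime_dijkstra_cand : polytime (fun z : nat * (seq (edge * nat) * edge) => dijkstra_cand
  z.1 z.2.1 z.2.2).
Proof.
apply: polytime_map; first by pt.
apply: polytime_filter; pt; apply: polytime_reached; pt.
Qed.

Lemma polytime_dijkstra_step : polytime (fun z : seq edge * (nat * seq (edge * nat)) =>
  dijkstra_step z.1 z.2.1 z.2.2).
Proof.
rewrite /dijkstra_step; apply: polytime_cat; last by pt.
apply: polytime_argmin; apply: polytime_flatten; apply: polytime_map; last by pt.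
by apply: (polytime_comp3 polytime_dijkstra_cand); pt.
Qed.

Lemma dijkstra_candP S T e c : c \in dijkstra_cand S T e ->
  exists2 t, t \in T & [/\ c = (e, t.2 + e.2.2), t.1.1 = e.2.1, e.1 \notin reached T &
    t.2 + e.2.2 <= S].
Proof. by case/mapP=> t; rewrite mem_filter => /andP[/and3P[/eqP ? ? ?] tT] ->; exists t. Qed.

Lemma esize_dijkstra_step E S T : esize (dijkstra_step E S T) <= esize T + (esize E + esize S + 3).
Proof.
rewrite /dijkstra_step; set l := flatten _.
case: (argminP l) => [[-> _] |[l1 [c [l2 [-> E2 _]]]]]; first exact: leq_addr.
have /flatten_mapP : c \in l by rewrite E2 mem_cat inE eqxx orbT.
move=> /= [] e => eE /dijkstra_candP[t _ [-> _ _ cS]].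
have dE : (esize (e : edge) < esize E)%N by apply: (@esize_mem _ _ E).
rewrite esize_cons esize_pair.
have dS : esize (t.2 + e.2.2) <= esize S by exact: leq_bits.
have aux a b m n d : a < b -> m <= n -> (a + m).+1 + d < d + (b + n + 3) by lia.
exact: aux dE dS.
Qed.

Lemma polytime_dijkstra : polytime (fun z : seq edge * (seq nat * (nat * nat)) =>
  dijkstra z.1 z.2.1 z.2.2.1 z.2.2.2).
Proof.
apply: (@polytime_foldl_add _ _ _ _ _ _ (fun z T _ => dijkstra_step z.1 z.2.2.1 T) _ _
  (fun z => esize z.1 + esize z.2.2.1 + 3)); pt.
- by apply: (polytime_comp3 polytime_dijkstra_step); pt.
- by pb.
- by move=> z T _ _; apply: esize_dijkstra_step.
Qed.

Lemma polytime_path_to : polytime (fun z : seq (edge * nat) * nat => path_to z.1 z.2).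
Proof.
apply: polytime_snd; apply: (@polytime_foldl_add _ _ _ _ _ _ (fun _ => path_step) _ _ (fun z =>
  esize z.1 * 2)); pt.
- by rewrite /path_step /=; apply: polytime_if; pt.
- by pb.
- move=> z [u pe] [[x [y w]] d]; rewrite /path_step /=; case: ifP => _ zt; last exact: leq_addr.
  move: zt; rewrite !esize_pair esize_cons !esize_pair; lia.
Qed.

(** [T] is arbitrary here: a polynomial-time function needs its size bound on all inputs, not only
    on lists produced by [dijkstra]. *)
Lemma esize_path_to T u : esize (path_to T u) <= 1 + size T * (esize T + 1).
Proof.
rewrite /path_to.
enough (H : forall (l : seq (edge * nat)) st, esize l <= esize T ->
    esize (foldl path_step st l).2 <= esize st.2 + size l * (esize T + 1)) by exact: H.
elim=> [|t l IH] st; first by rewrite addn0.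
rewrite esize_cons => lT; apply: leq_trans (IH _ _) _; first by lia.
rewrite /path_step; case: ifP => _ /=; last by lia.
rewrite esize_cons mulSn; case: t lT => e d; rewrite esize_pair /=; lia.
Qed.

Lemma polytime_walk : polytime (fun z : seq (edge * nat) * (state * nat) => walk z.1 z.2.1 z.2.2).
Proof.
have Pp : polytime (fun z : seq (edge * nat) * (state * nat) => path_to z.1 z.2.2).
  by apply: (polytime_comp2 polytime_path_to); pt.
apply: (@polytime_foldl_add _ _ _ _ _ _ (fun _ => extend) _ _ (fun z => 2 * esize (path_to z.1
  z.2.2) + 3)).
- by apply: (polytime_comp2 polytime_extend); pt.
- by [].
- by pt.
- by pb.
- by move=> z s e ez; apply: leq_trans (esize_extend s e) _; lia.
Qed.

(** With [p = 1 + m * (m + 1)] bounding the size of a path read off a list of size [m], this is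
    [p * (2 * p + 3)]: at most [p] extensions, each adding at most [2 * p + 3]. *)
Definition walk_cost (m : nat) : nat := (1 + m * (m + 1)) * (2 * (1 + m * (m + 1)) + 3).

Lemma esize_walk T s u : esize (walk T s u) <= esize s + walk_cost (esize T).
Proof.
apply: leq_trans (esize_extend_fold _ _) _; rewrite leq_add2l /walk_cost.
have H : esize (path_to T u) <= 1 + esize T * (esize T + 1).
  apply: leq_trans (esize_path_to T u) _; rewrite leq_add2l leq_mul2r.
  by rewrite (ltnW (size_esize _)) orbT.
apply: leq_mul; first exact: leq_trans (ltnW (size_esize _)) H.
by rewrite leq_add2r leq_mul2l.
Qed.

Lemma polytime_targets : polytime (fun z : seq edge * (seq nat * (nat * (seq (edge * nat) *
  state))) =>
  targets z.1 z.2.1 z.2.2.1 z.2.2.2.1 z.2.2.2.2).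
Proof.
apply: polytime_argmin; apply: polytime_map.
  by pt; apply: (polytime_comp4 polytime_light_comp); pt.
by apply: polytime_filter; [pt|apply: polytime_reached; pt].
Qed.

Definition round_cost (E : seq edge) (ns : seq nat) (T : seq (edge * nat)) : nat :=
  walk_cost (esize T) + esize ns * (esize E * (2 * esize E + 3)).

Lemma esize_light_grow_walk E ns th k T s u :
  esize (light_grow E ns th k (walk T s u)) <= esize s + round_cost E ns T.
Proof.
apply: leq_trans (esize_light_grow _ _ _ _ _) _; rewrite /round_cost addnA; apply: leq_add.
  exact: esize_walk.
apply: leq_mul; first exact: ltnW (size_esize _).
by apply: leq_mul => //; exact: ltnW (size_esize _).
Qed.

Lemma poly_bounded_round_cost X `{Enc X} (E : X -> seq edge) (ns : X -> seq nat) (T : X ->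
  seq (edge * nat)) :
  polytime E -> polytime ns -> polytime T -> poly_bounded (fun x => round_cost (E x) (ns x) (T x)).
Proof. by move=> PE Pn PT0; rewrite /round_cost /walk_cost; pb. Qed.

Lemma polytime_round : polytime (fun z : seq edge * (seq nat * (nat * (nat * (seq (edge * nat) *
  state)))) =>
  round z.1 z.2.1 z.2.2.1 z.2.2.2.1 z.2.2.2.2.1 z.2.2.2.2.2).
Proof.
apply: polytime_if; pt.
apply: (@polytime_foldl_add _ _ _ _ _ _
  (fun z s c => light_grow z.1 z.2.1 z.2.2.1 z.2.2.2.1 (walk z.2.2.2.2.1 s c.1)) _ _
  (fun z => round_cost z.1 z.2.1 z.2.2.2.2.1)); pt.
- by apply: (polytime_comp5 polytime_light_grow); pt; apply: (polytime_comp3 polytime_walk); pt.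
- by apply: (polytime_comp5 polytime_targets); pt.
- by apply: poly_bounded_round_cost; pt.
- by move=> z s c _; apply: esize_light_grow_walk.
Qed.

Lemma esize_round E ns th k T s : esize (round E ns th k T s) <= esize s + round_cost E ns T.
Proof.
rewrite /round; case: ifP => _; last exact: leq_addr.
rewrite /targets; case: (argminP [seq (u, size ns - size (light_comp E ns th u)) |
  u <- reached T & u \notin s.1]) => [[-> _]|[l1 [c [l2 [-> _ _]]]]] /=; first exact: leq_addr.
exact: esize_light_grow_walk.
Qed.

Lemma polytime_run : polytime (fun z : seq edge * (seq nat * (nat * (nat * (seq (edge * nat) *
  nat)))) =>
  run z.1 z.2.1 z.2.2.1 z.2.2.2.1 z.2.2.2.2.1 z.2.2.2.2.2).
Proof.
apply: (@polytime_foldl_add _ _ _ _ _ _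
  (fun z s _ => round z.1 z.2.1 z.2.2.1 z.2.2.2.1 z.2.2.2.2.1 s) _ _
  (fun z => round_cost z.1 z.2.1 z.2.2.2.2.1)); pt.
- by apply: (polytime_comp6 polytime_round); pt.
- by apply: (polytime_comp5 polytime_light_grow); pt; apply: polytime_single; pt.
- by apply: poly_bounded_round_cost; pt.
- by move=> z s c _; apply: esize_round.
Qed.

Lemma polytime_solve : polytime (fun z : seq edge * (seq nat * (nat * nat)) => solve z.1 z.2.1
  z.2.2.1 z.2.2.2).
Proof.
have Pr : polytime (fun z : seq edge * (seq nat * (nat * (nat * seq (edge * nat)))) =>
    runs_from z.1 z.2.1 z.2.2.1 z.2.2.2.1 z.2.2.2.2).
  apply: polytime_flatten; apply: polytime_map; last by apply: polytime_map; pt.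
  apply: polytime_map; last by pt; apply: polytime_map; pt.
  by apply: (polytime_comp6 polytime_run); pt; apply: polytime_filter; pt.
have Pc : polytime (fun z : seq edge * (seq nat * (nat * nat)) => candidates z.1 z.2.1 z.2.2.1
  z.2.2.2).
  apply: polytime_flatten; apply: polytime_map; last by pt.
  by apply: (polytime_comp5 Pr); pt; apply: (polytime_comp4 polytime_dijkstra); pt.
have Pa : polytime (fun z : seq edge * (seq nat * (nat * nat)) =>
    argmin [seq (s, s.2.2) | s <- candidates z.1 z.2.1 z.2.2.1 z.2.2.2 & z.2.2.1 <= size s.1]).
  by apply: polytime_argmin; apply: polytime_map; pt; apply: polytime_filter; pt.
apply: (@polytime_foldl_add _ _ _ _ _ _ (fun _ _ c => (c.1.1, c.1.2.1)) _ _ (fun z => esize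
  (argmin [seq (s, s.2.2) | s <- candidates z.1 z.2.1 z.2.2.1 z.2.2.2 & z.2.2.1 <= size s.1]))); pt.
- by pb.
- by move=> z b [[V [F c]] d]; rewrite !esize_pair /=; lia.
Qed.

(** * Grown trees and light components *)

Lemma foldl_inv (A : Type) (B : eqType) (P : A -> Prop) (f : A -> B -> A) (l : seq B) (a : A) :
  P a -> (forall b y, y \in l -> P b -> P (f b y)) -> P (foldl f a l).
Proof.
elim: l a => [//|y l IH] a Pa Hf /=; apply: IH => [|b z zl].
  by apply: Hf; rewrite ?mem_head.
by apply: Hf; rewrite inE zl orbT.
Qed.

Lemma foldl_const (A B : Type) (f : A -> A) (l : seq B) (a : A) :
  foldl (fun b _ => f b) a l = iter (size l) f a.
Proof. by elim: l a => [//|y l IH] a /=; rewrite IH -iterSr. Qed.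

Lemma seq_max (l : seq nat) (p : pred nat) m0 : m0 \in l -> p m0 ->
  exists m, [/\ m \in l, p m & forall x, x \in l -> p x -> x <= m].
Proof.
elim: l m0 => [//|y l IH] m0; case Hl: (has p l).
  move=> _ _; have /hasP[z zl pz] := Hl; have [m [ml pm Hm]] := IH z zl pz.
  case py: (p y); last first.
    exists m; split=> //; first by rewrite inE ml orbT.
    by move=> x; rewrite inE => /orP[/eqP->|]; [rewrite py|exact: Hm].
  exists (maxn y m); split.
  - by rewrite /maxn; case: ifP => _; rewrite inE ?ml ?eqxx ?orbT.
  - by rewrite /maxn; case: ifP.
  - by move=> x; rewrite inE leq_max => /orP[/eqP->|xl px]; rewrite ?leqnn // (Hm x xl px) orbT.
have {}Hl : forall x, x \in l -> ~~ p x by move=> x xl; apply: contraFN Hl => px; apply/hasP;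
  exists x.
rewrite inE => /orP[/eqP-> py|/Hl/negPf->//].
exists y; split; rewrite ?mem_head // => x; rewrite inE => /orP[/eqP->//|/Hl/negPf->//].
Qed.

(** Every attached edge brings a new node, so being a tree is built into the derivation and
    properties of trees follow by induction. The same notion describes the trees of the algorithm
    and the optimal tree. *)
Inductive grown (E : seq edge) (v : nat) : state -> Prop :=
| grown_single : grown E v (single v)
| grown_attach s (e : edge) : grown E v s -> e \in E -> e.2.1 \in s.1 -> e.1 \notin s.1 ->
    grown E v (attach s e).

Section Grown.
Variables (E : seq edge) (v : nat).

Lemma grown_extend s e : grown E v s -> e \in E -> grown E v (extend s e).
Proof. by rewrite /extend; case: ifP => // /andP[ys xs] gs eE; apply: grown_attach. Qed.

Lemma grown_uniq s : grown E v s -> uniq s.1.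
Proof. by elim=> // {}s e _ us _ _ /= ->. Qed.

Lemma grown_root s : grown E v s -> v \in s.1.
Proof. by elim=> [|{}s e _ vs _ _ _]; [exact: mem_head|rewrite /= inE vs orbT]. Qed.

Lemma grown_sub s (ns : seq nat) : (forall e, e \in E -> e.1 \in ns) -> v \in ns ->
  grown E v s -> {subset s.1 <= ns}.
Proof.
move=> En vn; elim=> [x|{}s e _ sn eE _ _ x]; rewrite /= inE; first by move/eqP->.
by case/orP=> [/eqP->|/sn//]; apply: En.
Qed.

Lemma extend_subset s e : {subset s.1 <= (extend s e).1}.
Proof. by rewrite /extend; case: ifP => _ x xs //; rewrite /= inE xs orbT. Qed.

Lemma light_step_id th cap s e : light_step th cap s e = s \/ size (light_step th cap s e).1 =
  (size s.1).+1.
Proof. by rewrite /light_step /extend; do 2?case: ifP => _; [right|left|left]. Qed.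

Lemma light_pass_progress th cap s :
  light_pass E th cap s = s /\ (forall e, e \in E -> light_step th cap s e = s) \/
  size s.1 < size (light_pass E th cap s).1.
Proof.
rewrite /light_pass; elim: E s => [|e l IH] s; first by left.
have mono : size (light_step th cap s e).1 <= size (foldl (light_step th cap) (light_step th cap s
  e) l).1.
  apply: (foldl_inv (P := fun s' => size (light_step th cap s e).1 <= size s'.1)) => // s' y _ le.
  by apply: leq_trans le _; case: (light_step_id th cap s' y) => ->.
case: (light_step_id th cap s e) => [Es|szS] /=; last by right; rewrite szS in mono.
rewrite Es; case: (IH s) => [[-> Hl]|]; [left|by right].
by split=> // z; rewrite inE => /orP[/eqP->|/Hl].
Qed.

Definition light_closed (th : nat) (S : pred nat) : Prop :=
  forall e : edge, e \in E -> e.2.2 <= th -> S e.2.1 -> S e.1.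

(** After [i] passes the state is stuck or has gained at least [i] nodes. With [i = size ns] the
    second case reaches the cap, and a state stuck below the cap has no light edge leaving it. *)
Lemma light_growP ns th cap s : 0 < size s.1 -> cap <= size ns ->
  cap <= size (light_grow E ns th cap s).1 \/ light_closed th (mem (light_grow E ns th cap s).1).
Proof.
move=> s0 capn; rewrite /light_grow foldl_const.
pose stuck s' := forall e, e \in E -> light_step th cap s' e = s'.
have H i : stuck (iter i (light_pass E th cap) s) \/ size s.1 + i <=
  size (iter i (light_pass E th cap) s).1.
  elim: i => [|i IH]; first by right; rewrite addn0.
  rewrite iterS; move: IH; set s' := iter i _ s.
  case: (light_pass_progress th cap s') => [[-> Hs'] _|lt]; first by left.
  case=> [st|le]; last by right; lia.
  left; suff -> : light_pass E th cap s' = s' by [].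
  apply: (foldl_inv (P := fun s => s = s')) => // b y yE ->; exact: st.
case: (H (size ns)) => [|le]; last by left; lia.
set s' := iter _ _ s => st; case: (leqP cap (size s'.1)) => [|lt]; [by left|right].
move=> e eE eth /= ys; apply: contraT => xs; have := st e eE.
rewrite /light_step lt eth /extend ys xs => /(congr1 (fun s : state => size s.1)) /=; lia.
Qed.

Lemma light_grow_inv (P : state -> Prop) ns th cap s :
  (forall s (e : edge), e \in E -> e.2.2 <= th -> size s.1 < cap -> P s -> P (extend s e)) ->
  P s -> P (light_grow E ns th cap s).
Proof.
move=> Pext Ps; apply: foldl_inv => // s' _ _ Ps'; apply: foldl_inv => // s'' e eE Ps''.
by rewrite /light_step; case: ifP => // /andP[lt le]; apply: Pext.
Qed.

Lemma grown_light_grow ns th cap s : grown E v s -> grown E v (light_grow E ns th cap s).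
Proof. by apply: light_grow_inv => s' e eE _ _ gs; apply: grown_extend. Qed.

Lemma light_grow_subset ns th cap s : {subset s.1 <= (light_grow E ns th cap s).1}.
Proof.
apply: (light_grow_inv (P := fun s' => {subset s.1 <= s'.1})) => // s' e _ _ _ ss' x /ss'.
exact: extend_subset.
Qed.

Lemma light_grow_min ns th cap s (S : pred nat) : light_closed th S -> {subset s.1 <= S} ->
  {subset (light_grow E ns th cap s).1 <= S}.
Proof.
move=> cS; apply: (light_grow_inv (P := fun s' => {subset s'.1 <= S})) => s' e eE eth _ sS x.
rewrite /extend; case: ifP => [/andP[ys _]|_]; last exact: sS.
by rewrite /= inE => /orP[/eqP->|/sS//]; apply: cS => //; apply: sS.
Qed.

(** An attachment below the cap costs at most [th] and raises the minimum by one. The term [th] on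
    the left reflects that a tree has one edge fewer than nodes. *)
Lemma light_grow_cost ns th cap H s : 0 < size s.1 ->
  s.2.2 + th <= th * minn (size s.1) cap + H ->
  (light_grow E ns th cap s).2.2 + th <= th * minn (size (light_grow E ns th cap s).1) cap + H.
Proof.
move=> s0 Hs.
pose P (s : state) := s.2.2 + th <= th * minn (size s.1) cap + H.
suff: P (light_grow E ns th cap s) by [].
apply: (light_grow_inv (P := P)) Hs => {s s0} s e eE eth lt; rewrite /P /extend;
  case: ifP => // _ /=.
have -> : minn (size s.1).+1 cap = (minn (size s.1) cap).+1 by lia.
rewrite mulnS; lia.
Qed.

End Grown.

Section Components.
Variables (E : seq edge) (ns : seq nat) (th : nat).
Hypothesis Esym : forall x y w, (x, (y, w)) \in E -> (y, (x, w)) \in E.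
Hypothesis Ens : forall e, e \in E -> e.1 \in ns.
Notation C := (light_comp E ns th).
Notation light_closed := (light_closed E th).

Lemma light_comp_grown u : grown E u (light_grow E ns th (size ns) (single u)).
Proof. by apply: grown_light_grow; constructor. Qed.

Lemma light_comp_self u : u \in C u.
Proof. by apply: (@light_grow_subset E ns th (size ns) (single u)); exact: mem_head. Qed.

Lemma light_comp_uniq u : uniq (C u).
Proof. exact: grown_uniq (light_comp_grown u). Qed.

Lemma light_comp_sub u : u \in ns -> {subset C u <= ns}.
Proof. by move=> un; apply: grown_sub (light_comp_grown u). Qed.

Lemma light_comp_closed u : u \in ns -> light_closed (mem (C u)).
Proof.
move=> un; case: (@light_growP E ns th (size ns) (single u) isT (leqnn _)) => //.
rewrite -/(C u) => szn e eE _ _ /=.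
(* A duplicate-free list of nodes that is as long as [ns] contains all of them, so it is trivially
   closed. *)
by have [_ ->] := uniq_min_size (light_comp_uniq u) (light_comp_sub un) szn; apply: Ens.
Qed.

Lemma light_comp_min u (S : pred nat) : light_closed S -> S u -> {subset C u <= S}.
Proof. by move=> cS Su; apply: light_grow_min => // x; rewrite inE => /eqP->. Qed.

(** The symmetry of [E] enters here: reversing an edge gives the contrapositive. It follows that
    light components are equal or disjoint. *)
Lemma light_closedC (S : pred nat) : light_closed S -> light_closed (predC S).
Proof.
by move=> cS [x [y w]] /Esym xE wth; apply: contra => Sx; apply: (cS _ xE).
Qed.

Lemma light_comp_disjoint u (S : pred nat) : light_closed S -> ~~ S u -> forall x, x \in C u ->
  ~~ S x.
Proof. by move=> cS Su; apply: light_comp_min (light_closedC cS) _. Qed.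

Lemma light_comp_eq u x : u \in ns -> x \in ns -> u \in C x -> C x =i C u.
Proof.
move=> un xn ux; have cu := light_comp_closed un.
have xu : x \in C u.
  apply: contraT => /(light_comp_disjoint cu)/(_ _ ux) /=.
  by rewrite light_comp_self.
have Cux := light_comp_min (light_comp_closed xn) ux.
have Cxu := light_comp_min cu xu.
by move=> y; apply/idP/idP => [/Cxu|/Cux].
Qed.

End Components.

(** * Shortest paths *)

(** Only the tree structure and the lengths of its paths are recorded. That the paths are shortest
    is kept apart, in [settled] and [frontier_ge], so that the list can be cut at distance [D]. *)
Inductive spt (E : seq edge) (v : nat) : seq (edge * nat) -> Prop :=
| spt_root : spt E v [:: ((v, (v, 0)), 0)]
| spt_step T (t : edge * nat) (e : edge) : spt E v T -> e \in E -> t \in T ->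
    t.1.1 = e.2.1 -> e.1 \notin reached T -> spt E v ((e, t.2 + e.2.2) :: T).

Section Sptree.
Variables (E : seq edge) (v : nat).

Lemma mem_dnodes (T : seq (edge * nat)) t : t \in T -> t.1.1 \in reached T.
Proof. exact: (map_f (fun t : edge * nat => t.1.1)). Qed.

(** A node is never closer to the root than its parent, so a cut at distance [D] keeps the parent of
    every entry it keeps. *)
Lemma spt_within T D : spt E v T -> spt E v (within D T).
Proof.
elim=> [|{}T t e _ IH eE tT te eT]; first exact: spt_root.
rewrite /within /=; case: ifP => // le; apply: spt_step => //.
  by rewrite mem_filter tT andbT; apply: leq_trans le; rewrite leq_addr.
by apply: contra eT => /mapP[t' +  ->]; rewrite mem_filter => /andP[_ /mem_dnodes].
Qed.

Lemma spt_uniq T : spt E v T -> uniq (reached T).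
Proof. by elim=> [|{}T t e _ IH _ _ _ eT] //; rewrite /= eT. Qed.

Lemma spt_has_root T : spt E v T -> ((v, (v, 0)), 0) \in T.
Proof. by elim=> [|{}T t e _ vT _ _ _ _]; rewrite inE ?eqxx // vT orbT. Qed.

Lemma path_to_cons T t u :
  path_to (t :: T) u = if t.1.1 == u then rcons (path_to T t.1.2.1) t.1 else path_to T u.
Proof.
have H : forall (T : seq (edge * nat)) u pe, (foldl path_step (u, pe) T).2 = path_to T u ++ pe.
  elim=> [//|{}t {}T IH] {}u pe; rewrite /path_to /= /path_step /=.
  by case: ifP => _; rewrite !IH // -catA.
rewrite /path_to /= /path_step /=; case: ifP => // _.
by rewrite H cats1.
Qed.

Lemma walk_cons T t s u :
  walk (t :: T) s u = if t.1.1 == u then extend (walk T s t.1.2.1) t.1 else walk T s u.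
Proof. by rewrite /walk path_to_cons; case: ifP => // _; rewrite foldl_rcons. Qed.

(** [extend] skips nodes that the tree already has, so following a path that re-enters the tree
    still produces a tree, and costs at most the length of the path. *)
Lemma walkP T r s (t : edge * nat) : spt E v T -> grown E r s -> v \in s.1 -> t \in T ->
  [/\ grown E r (walk T s t.1.1), t.1.1 \in (walk T s t.1.1).1,
      {subset s.1 <= (walk T s t.1.1).1} & (walk T s t.1.1).2.2 <= s.2.2 + t.2].
Proof.
move=> sT gs vs; elim: sT t => [t|{}T t e sT IH eE tT te eT t'].
  rewrite inE => /eqP->; rewrite /walk /path_to /= /path_step /= eqxx /= /extend /= vs addn0 /=.
  by split.
rewrite inE => /orP[/eqP->|t'T]; rewrite walk_cons /=.
  rewrite eqxx -te; have [g1 t1 sub1 c1] := IH t tT.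
  split; first exact: grown_extend.
  - by rewrite /extend -te t1 /=; case: ifP => [_|/negbFE]; rewrite //= mem_head.
  - by move=> x /sub1; apply: extend_subset.
  - by rewrite /extend; case: ifP => _ /=; lia.
case: eqP => [E'|_]; last exact: IH.
by rewrite E' mem_dnodes in eT.
Qed.

Lemma spt_sub (ns : seq nat) T : (forall e, e \in E -> e.1 \in ns) -> v \in ns ->
  spt E v T -> {subset reached T <= ns}.
Proof.
move=> En vn; elim=> [x|{}T t e _ IH eE _ _ _ x] /=; rewrite inE; first by move/eqP->.
by case/orP=> [/eqP->|/IH//]; apply: En.
Qed.

(** * Correctness of Dijkstra's algorithm *)

Variables (ns : seq nat) (S : nat).
Hypothesis Ens : forall e, e \in E -> e.1 \in ns.
Hypothesis vns : v \in ns.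

Definition settled (T : seq (edge * nat)) : Prop :=
  forall (t1 t2 : edge * nat) (e : edge), t1 \in T -> t2 \in T -> e \in E ->
    e.2.1 = t1.1.1 -> e.1 = t2.1.1 -> t2.2 <= t1.2 + e.2.2.

Definition frontier_ge (T : seq (edge * nat)) (d : nat) : Prop :=
  forall (t : edge * nat) (e : edge), t \in T -> e \in E ->
    e.2.1 = t.1.1 -> e.1 \notin reached T -> d <= t.2 + e.2.2.

(** The last clause expresses that nodes are entered in order of distance: whatever is entered next
    is at least as far as all present entries. This settles the edges from a new node back to old
    ones. *)
Definition dinv (T : seq (edge * nat)) : Prop :=
  [/\ spt E v T, settled T & forall t, t \in T -> frontier_ge T t.2].

Lemma dijkstra_stepP T : dinv T ->
  dinv (dijkstra_step E S T) /\
  (frontier_ge T S.+1 /\ dijkstra_step E S T = T \/ size (dijkstra_step E S T) = (size T).+1).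
Proof.
move=> inv; have [sT setT front] := inv; rewrite /dijkstra_step; set l := flatten _.
have lP (t : edge * nat) (e : edge) : t \in T -> e \in E -> e.2.1 = t.1.1 -> e.1 \notin reached T ->
    t.2 + e.2.2 <= S -> (e, t.2 + e.2.2) \in l.
  move=> tT eE et eT le; apply/flatten_mapP; exists e => //; apply/mapP; exists t => //.
  by rewrite mem_filter et eqxx eT le.
case El: (argmin l) => [|c r].
  split=> //=; left; split=> // t e tT eE et eT; rewrite ltnNge; apply/negP=> le.
  by have := lP t e tT eE et eT le; rewrite (argmin_nil El).
have cl : c \in argmin l by rewrite El mem_head.
have [E1 {}cl cmin] := argmin_mem cl; move: El; rewrite E1 => -[<-] {r}.
have /flatten_mapP[e eE /dijkstra_candP[t tT [Ec te eT leS]]] := cl.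
rewrite {c}Ec in E1 cl cmin *; rewrite /= in cmin.
(* A frontier edge either yields a candidate, which is no shorter than the minimum, or exceeds the
   cap [S] and hence the minimum as well. *)
have fr : frontier_ge T (t.2 + e.2.2).
  move=> t' e' t'T e'E e't' e'T; case: (leqP (t'.2 + e'.2.2) S) => [le|]; last by move/ltnW;
    apply: leq_trans.
  exact: (cmin _ (lP t' e' t'T e'E e't' e'T le)).
split; last by right.
split; first exact: spt_step.
- move=> t1 t2 e'; rewrite !inE => /orP[/eqP->|t1T] /orP[/eqP->|t2T] e'E /= h1 h2.
  + by rewrite leq_addr.
  + by apply: leq_trans (front t2 t2T t e tT eE _ eT) (leq_addr _ _).
  + by apply: fr => //; rewrite h2.
  + exact: setT.
- move=> t1; rewrite inE => t1T t2 e'; rewrite inE => t2T e'E h1;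
  rewrite /= inE negb_or => /andP[_ e'T].
  have d1 : t1.2 <= t.2 + e.2.2.
    by case/orP: t1T => [/eqP->//|t1T]; apply: (front t1 t1T t e).
  case/orP: t2T h1 => [/eqP->|t2T] h1 /=; first exact: leq_trans d1 (leq_addr _ _).
  by apply: leq_trans d1 _; apply: fr.
Qed.

(** After [i] steps either nothing within [S] is left or there are [i.+1] entries. For [i = size ns]
    the latter would give more distinct nodes than exist. *)
Lemma dijkstraP : let T := dijkstra E ns S v in
  [/\ spt E v T, settled T & frontier_ge T S.+1].
Proof.
rewrite /= /dijkstra foldl_const; set T0 := [:: _].
have inv0 : dinv T0.
  split; first exact: spt_root.
    by move=> t1 t2 e; rewrite !inE => _ /eqP->.
  by move=> t; rewrite inE => /eqP->.
have H i : dinv (iter i (dijkstra_step E S) T0) /\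
   (frontier_ge (iter i (dijkstra_step E S) T0) S.+1 /\
      dijkstra_step E S (iter i (dijkstra_step E S) T0) = iter i (dijkstra_step E S) T0 \/
    size (iter i (dijkstra_step E S) T0) = i.+1).
  elim: i => [|i [IH1 IH2]]; first by split=> //; right.
  rewrite iterS; have [inv st] := dijkstra_stepP IH1; split=> //.
  case: IH2 => [[fr Ed]|sz]; first by rewrite !Ed; left.
  by case: st => [[fr Ed]|->]; [rewrite !Ed; left|right; rewrite sz].
have [[sT setT _] [[fr _]|sz]] := H (size ns); first by split.
have := uniq_leq_size (spt_uniq sT) (spt_sub Ens vns sT).
by rewrite size_map sz ltnn.
Qed.

(** Distances are compared with the cost of the whole tree, which is all that the choice of [D]
    needs. A node missing from the list would have a frontier edge beyond [S], against
    [s.2.2 <= S]. *)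
Lemma dijkstra_le s : grown E v s -> s.2.2 <= S -> forall x, x \in s.1 ->
  exists t : edge * nat, [/\ t \in dijkstra E ns S v, t.1.1 = x & t.2 <= s.2.2].
Proof.
have [sT setT fr] := dijkstraP; set T := dijkstra _ _ _ _ in sT setT fr *.
elim=> [|{}s e gs IH eE ys xs] /= leS x; rewrite inE.
  by move/eqP->; exists ((v, (v, 0)), 0); split=> //; apply: spt_has_root sT.
have {}IH := IH (leq_trans (leq_addr _ _) leS).
case/orP=> [/eqP->|/IH[t [tT <- le]]]; last by exists t; split=> //; lia.
have [t1 [t1T E1 le1]] := IH _ ys.
case: (boolP (e.1 \in reached T)) => [/mapP[t2 t2T E2]|eT].
  exists t2; split=> //; have := setT t1 t2 e t1T t2T eE (esym E1) E2; lia.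
have := fr t1 e t1T eE (esym E1) eT; lia.
Qed.

End Sptree.

(** * Analysis of the rounds *)

Section Heavy.
Variables (E : seq edge) (ns : seq nat) (th : nat).
Hypothesis Ens : forall e : edge, e \in E -> e.1 \in ns.

(* [c] is the least weight of the [size xs] edges of the tree heavier than [th], if any. *)
Lemma grown_heavy v s : v \in ns -> grown E v s ->
  exists (xs : seq nat) (c : nat),
    [/\ {subset xs <= s.1}, size xs < size s.1, size xs * c <= s.2.2,
      0 < size xs -> th < c /\ exists2 e, e \in E & e.2.2 = c &
      forall x, x \in s.1 -> exists2 y, y \in v :: xs & x \in light_comp E ns th y].
Proof.
move=> vn; elim=> [|{}s e gs [xs [c [sub sz cost heavy cover]]] eE ys xs'].
  exists [::], 0; split=> // x; rewrite inE => /eqP->.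
  by exists v; rewrite ?mem_head //; apply: light_comp_self.
case: (leqP e.2.2 th) => [le|lt].
  exists xs, c; split=> //=.
  - by move=> x /sub xs1; rewrite inE xs1 orbT.
  - exact: ltnW.
  - lia.
  - move=> x; rewrite inE => /orP[/eqP->|/cover//].
    have [y yxs yC] := cover _ ys; exists y => //.
    have yn : y \in ns.
      by move: yxs; rewrite inE => /orP[/eqP->//|/sub]; apply: grown_sub gs _.
    by apply: (light_comp_closed Ens yn eE le yC).
(* The far end of a heavy edge represents a new light component. The initial value 0 of [c] is not
   the weight of a heavy edge, so the first one replaces it instead of entering a minimum. *)
exists (e.1 :: xs), (if xs is [::] then e.2.2 else minn c e.2.2); split=> //=.
- by move=> x; rewrite !inE => /orP[->//|/sub->]; rewrite orbT.
- case: xs sub sz cost {heavy cover} => [|y xs] sub sz cost; rewrite mulSn addnC.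
    by rewrite leq_add.
  rewrite leq_add ?geq_minr //; apply: leq_trans cost.
  by rewrite leq_mul2l geq_minl orbT.
- move=> _; case: xs heavy {sub sz cost cover} => [|y xs] heavy.
    by split=> //; exists e.
  have [hc [e' e'E e'c]] := heavy isT; rewrite /minn.
  by case: ifP => _; split=> //; [exists e'|exists e].
- move=> x; rewrite inE => /orP[/eqP->|/cover[y yxs yC]].
    by exists e.1; [rewrite !inE eqxx orbT|apply: light_comp_self].
  by exists y => //; move: yxs; rewrite !inE => /orP[->//|->]; rewrite !orbT.
Qed.

End Heavy.

Section Rounds.
Variables (E : seq edge) (ns : seq nat) (th k v D : nat) (T : seq (edge * nat)).
Hypothesis Esym : forall x y w, (x, (y, w)) \in E -> (y, (x, w)) \in E.
Hypothesis Ens : forall e : edge, e \in E -> e.1 \in ns.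
Hypothesis vns : v \in ns.
Hypothesis kn : k <= size ns.
Hypothesis sT : spt E v T.
Hypothesis TD : forall t, t \in T -> t.2 <= D.
Notation C := (light_comp E ns th).

(** Duplicates are removed because the length is used as the number of covered nodes, while the
    components may overlap each other and the tree. *)
Definition cover (s : state) (xs : seq nat) : seq nat :=
  undup (s.1 ++ flatten [seq C x | x <- xs]).

Lemma mem_cover s xs x :
  reflect (x \in s.1 \/ exists2 y, y \in xs & x \in C y) (x \in cover s xs).
Proof.
rewrite mem_undup mem_cat; apply: (iffP orP) => -[?|H]; [by left| |by left|].
  by right; apply/flatten_mapP.
by right; apply/flatten_mapP.
Qed.

Lemma reached_nodes : {subset reached T <= ns}.
Proof. exact: spt_sub Ens vns sT. Qed.

Lemma targetsP s c : c \in targets E ns th T s ->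
  [/\ c.1 \in reached T, c.1 \notin s.1, targets E ns th T s = [:: c] &
    forall x, x \in reached T -> x \notin s.1 -> size (C x) <= size (C c.1)].
Proof.
move=> ct; have [E1 /mapP[u]] := argmin_mem ct.
rewrite mem_filter => /andP[us uT] Ec cmin; rewrite {}Ec /= in ct E1 cmin *.
split=> // x xT xs.
have /cmin /= : (x, size ns - size (C x)) \in
    [seq (u, size ns - size (C u)) | u <- reached T & u \notin s.1].
  by apply/mapP; exists x; rewrite // mem_filter xs.
by rewrite leq_sub2lE // (uniq_leq_size (light_comp_uniq E ns th x) (light_comp_sub Ens
  (reached_nodes xT))).
Qed.

Lemma round_grown s : grown E v s -> grown E v (round E ns th k T s).
Proof.
rewrite /round => gs; case: ifP => // _.
apply: foldl_inv => // {gs}s' c /targetsP[/mapP[t tT ->] _ _ _] gs.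
by apply: grown_light_grow; case: (walkP sT gs (grown_root gs) tT).
Qed.

Lemma run_grown : grown E v (run E ns th k T v).
Proof.
rewrite /run foldl_const; elim: (size ns) => [|i IH].
  by apply: grown_light_grow; constructor.
by rewrite iterS; apply: round_grown.
Qed.

(* Amortised cost: an edge of weight at most [th] is attached only below [k] nodes, and so is paid
   for by the growth of [minn (size s.1) k]; shortest paths are paid for by [H]. *)
Definition charged (H : nat) (s : state) : Prop :=
  s.2.2 + th <= th * minn (size s.1) k + H.

Lemma charged_le H H' s : H <= H' -> charged H s -> charged H' s.
Proof. by move=> le ch; apply: leq_trans ch _; rewrite leq_add2l. Qed.

(** [r] is the number of shortest paths that may still be required, and [H] the amount already spent
    on such paths. Below [k] nodes, components of [r] reachable nodes suffice to complete the
    tree. *)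
Definition rinv (r H : nat) (s : state) : Prop :=
  [/\ grown E v s, charged H s &
    k <= size s.1 \/ light_closed E th (mem s.1) /\
    exists xs, [/\ size xs <= r, {subset xs <= reached T} & k <= size (cover s xs)]].

Lemma round_done s : k <= size s.1 -> round E ns th k T s = s.
Proof. by rewrite /round leqNgt; case: ifP. Qed.

(* Either the chosen component [C u] is one of the [C x], and then [x] is dropped, or it is
   disjoint from all of them and at least as large as any of those not yet reached. *)
Lemma cover_exchange s s2 u x0 xs :
  {subset s.1 <= s2.1} -> uniq s.1 -> light_closed E th (mem s.1) -> {subset C u <= s2.1} ->
  {subset xs <= ns} -> u \in ns -> u \notin s.1 -> x0 \in xs ->
  size (C x0) <= size (C u) ->
  exists2 x, x \in xs & size (cover s xs) <= size (cover s2 (rem x xs)).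
Proof.
move=> ss2 us cs Cus2 xsn un us1 x0xs Cle.
have remP x y : x \in xs -> y \in xs -> y = x \/ y \in rem x xs.
  by move=> xxs; rewrite (perm_mem (perm_to_rem xxs)) inE => /orP[/eqP|]; [left|right].
case: (boolP (has (fun x => u \in C x) xs)) => [/hasP[x xxs ux]|/hasPn dis].
  exists x => //; apply: uniq_leq_size; first exact: undup_uniq.
  move=> y /mem_cover[/ss2 ys|[z zxs yz]]; apply/mem_cover; first by left.
  case: (remP x z xxs zxs) yz => [->|zr] yz; last by right; exists z.
  by left; apply: Cus2; rewrite -(light_comp_eq Esym Ens un (xsn _ xxs) ux).
exists x0 => //.
have le1 : size (cover s xs) <= size (cover s (rem x0 xs) ++ C x0).
  apply: uniq_leq_size; first exact: undup_uniq.
  move=> y /mem_cover[ys|[z zxs yz]]; rewrite mem_cat.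
    by apply/orP; left; apply/mem_cover; left.
  case: (remP x0 z x0xs zxs) yz => [->->|zr yz]; first by rewrite orbT.
  by apply/orP; left; apply/mem_cover; right; exists z.
apply: leq_trans le1 _; rewrite size_cat.
apply: (@leq_trans (size (cover s (rem x0 xs) ++ C u))); first by rewrite size_cat leq_add2l.
apply: uniq_leq_size.
  rewrite cat_uniq undup_uniq light_comp_uniq andbT; apply/hasPn => y yu.
  apply/negP=> /mem_cover[ys|[z /mem_rem zxs yz]].
    by have /negP := light_comp_disjoint Esym cs us1 yu.
  by have /negP := light_comp_disjoint Esym (light_comp_closed Ens (xsn _ zxs)) (dis z zxs) yu.
move=> y; rewrite mem_cat => /orP[/mem_cover[/ss2 ys|H]|/Cus2 ys]; apply/mem_cover.
- by left.
- by right.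
- by left.
Qed.

Lemma round_step r H s : rinv r H s -> size s.1 < k ->
  0 < r /\ rinv r.-1 (H + D) (round E ns th k T s).
Proof.
move=> [gs ch st] lt; rewrite leqNgt lt in st; case: st => // -[cs [xs [sz xsT kc]]].
have us := grown_uniq gs.
(* Otherwise the closed tree would contain the components of all nodes of [xs], hence the whole
   cover, and would already have [k] nodes. *)
have [x0 x0xs x0s] : exists2 x0, x0 \in xs & x0 \notin s.1.
  apply/hasP; apply: contraT; rewrite -all_predC => /allP Hxs.
  move: kc; rewrite leqNgt => /negP[]; apply: leq_ltn_trans lt.
  apply: uniq_leq_size; first exact: undup_uniq.
  move=> y /mem_cover[//|[x xxs yx]]; apply: (light_comp_min cs) yx.
  by have := Hxs x xxs; rewrite /= negbK.
have r0 : 0 < r by apply: leq_trans sz; case: (xs) x0xs.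
split=> //.
have [c ctar] : exists c, targets E ns th T s = [:: c].
  apply: (@argmin_cons _ _ (x0, size ns - size (C x0))).
  by apply/mapP; exists x0 => //; rewrite mem_filter x0s xsT.
have [uT us1 _ umax] : [/\ c.1 \in reached T, c.1 \notin s.1, targets E ns th T s = [:: c] &
    forall x, x \in reached T -> x \notin s.1 -> size (C x) <= size (C c.1)].
  by apply: targetsP; rewrite ctar mem_head.
rewrite /round lt ctar /=.
move: (c.1) uT us1 umax => u uT us1 umax {c ctar}.
have un := reached_nodes uT.
have [t tT Eu] : exists2 t : edge * nat, t \in T & u = t.1.1 by exact/mapP.
have [g1 u1 sub1 c1] := walkP sT gs (grown_root gs) tT.
rewrite -Eu in g1 u1 sub1 c1 *.
set s1 := walk T s u in g1 u1 sub1 c1 *.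
have sz1 : 0 < size s1.1 by case: (s1.1) u1.
have g2 : grown E v (light_grow E ns th k s1) by apply: grown_light_grow.
have sub2 := @light_grow_subset E ns th k s1.
have clo := @light_growP E ns th k s1 sz1 kn.
have ch2 : charged (H + D) (light_grow E ns th k s1).
  (* The path is paid for by [D], and the nodes it adds can only increase the term with the minimum.
     They may push the tree beyond [k] nodes, which is why that term is capped. *)
  apply: light_grow_cost => //; have tD : t.2 <= D by apply: TD.
  have : size s.1 <= size s1.1 by apply: uniq_leq_size.
  move: ch; rewrite /charged => ch szs.
  have : th * minn (size s.1) k <= th * minn (size s1.1) k by rewrite leq_mul2l; lia.
  lia.
split=> //; case: clo => [?|cl2]; [by left|right; split=> //].
have [||||x xxs le] := @cover_exchange s (light_grow E ns th k s1) u x0 xs _ us cs _ _ un us1 x0xs.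
- by move=> x /sub1 /sub2.
- by apply: light_comp_min cl2 _; apply: sub2.
- by move=> x /xsT /reached_nodes.
- by apply: umax => //; apply: xsT.
exists (rem x xs); split.
- by rewrite size_rem //; lia.
- by move=> y /mem_rem /xsT.
- exact: leq_trans kc le.
Qed.

(** Below [k] nodes a round lowers [r] and spends at most [D] on a path, and [r = 0] is impossible
    there, so [k] is reached in time. Further rounds change nothing. *)
Lemma rounds r H s i : rinv r H s -> r <= i ->
  let s' := iter i (round E ns th k T) s in k <= size s'.1 /\ charged (H + r * D) s'.
Proof.
move=> inv ri; case: (leqP k (size s.1)) => [le|lt].
  have -> : iter i (round E ns th k T) s = s.
    by elim: (i) => [//|j IH]; rewrite iterS IH round_done.
  by split=> //; case: inv => _ + _; apply: charged_le; rewrite leq_addr.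
elim: i r H s inv ri lt => [|i IH] r H s inv ri lt; first by have [] := round_step inv lt; lia.
have [r0 inv'] := round_step inv lt.
have E' : H + r * D = H + D + r.-1 * D by rewrite -addnA -mulSn prednK.
rewrite iterSr E'; set s' := round E ns th k T s in inv' *.
case: (leqP k (size s'.1)) => [le|lt']; last by apply: IH => //; lia.
have -> : iter i (round E ns th k T) s' = s'.
  by elim: (i) => [//|j IHj]; rewrite iterS IHj round_done.
by split=> //; case: inv' => _ + _; apply: charged_le; rewrite leq_addr.
Qed.

End Rounds.

(** If [m > 0], then [m^2 c^2 <= L^2 < k c^2], so [m^2 <= k]. Now [(th k)^2] and [(m L)^2] are both
    at most [k L^2], and [(a + b)^2 <= 2 a^2 + 2 b^2] yields the factor 4. *)
Lemma sqrt_bound th k m L D c cost :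
  th * th * k <= L * L -> D <= L -> m * c <= L -> (0 < m -> L * L < c * c * k) ->
  0 < k -> cost + th <= th * k + m * D -> cost * cost <= 4 * k * (L * L).
Proof.
move=> Hth HD Hm Hc k0 Hcost.
have mk : m * m <= k.
  case: (posnP m) => [->//|m0]; have {}Hc := Hc m0.
  have : m * m * (c * c) <= k * (c * c).
    apply: leq_trans (_ : L * L <= _); first by rewrite mulnACA leq_mul.
    by apply: ltnW; rewrite [k * _]mulnC.
  by rewrite leq_pmul2r //; nia.
have a2 : (th * k) * (th * k) <= k * (L * L).
  by rewrite mulnACA [in leqLHS]mulnA [in leqLHS]mulnC leq_mul.
have b2 : (m * L) * (m * L) <= k * (L * L) by rewrite mulnACA leq_mul.
have le : cost <= th * k + m * L.
  have : m * D <= m * L by rewrite leq_mul2l HD orbT.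
  lia.
have H := leq_mul le le.
have H2 : (th * k + m * L) * (th * k + m * L) <= 2 * ((th * k) * (th * k)) + 2 * ((m * L) * (m *
  L)).
  move: (th * k) (m * L) => a b; have [+ _] := nat_Cauchy a b.
  by rewrite -!mulnn; nia.
move: a2 b2 H H2; rewrite -[4 * k * _]mulnA; move: (k * _) => N.
move: (th * k) (m * L) => a b; move: (a * a) (b * b) => p q; lia.
Qed.

(** * Comparison with an optimal tree *)

Section Solve.
Variables (E : seq edge) (ns : seq nat) (k S : nat).
Hypothesis Esym : forall x y w, (x, (y, w)) \in E -> (y, (x, w)) \in E.
Hypothesis Ens : forall e : edge, e \in E -> e.1 \in ns.
Hypothesis k0 : 0 < k.
Hypothesis kn : k <= size ns.

Lemma good_run v sO : v \in ns -> grown E v sO -> k <= size sO.1 -> sO.2.2 <= S ->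
  exists2 s, s \in candidates E ns k S &
    k <= size s.1 /\ s.2.2 * s.2.2 <= 4 * k * (sO.2.2 * sO.2.2).
Proof.
move=> vn gO kO OS; set L := sO.2.2.
have [sT0 _ _] := dijkstraP S Ens vn.
have dle := dijkstra_le Ens vn gO OS; set T0 := dijkstra E ns S v in sT0 dle *.
have root : ((v, (v, 0)), 0) \in T0 := spt_has_root sT0.
have [|//|D [DT DL Dmax]] := @seq_max [seq t.2 | t <- T0] (fun d => d <= L) 0.
  by apply/mapP; exists ((v, (v, 0)), 0).
have [||th [thE thL thmax]] :=
  @seq_max (0 :: [seq e.2.2 | e <- E]) (fun w => w * w * k <= L * L) 0.
- exact: mem_head.
- by rewrite !mul0n.
have sT := spt_within D sT0; set T := within D T0 in sT *.
have TD t : t \in T -> t.2 <= D by rewrite mem_filter => /andP[].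
have OT x : x \in sO.1 -> x \in reached T.
  move=> /dle[t [tT <- le]]; apply: mem_dnodes; rewrite mem_filter tT andbT.
  by apply: Dmax => //; apply: map_f.
have [xs [c [xsO szx cost heavy cov]]] := grown_heavy th Ens vn gO.
pose s0 := light_grow E ns th k (single v).
have gs0 : grown E v s0 by apply: grown_light_grow; constructor.
have inv : rinv E ns th k v T (size xs) 0 s0.
  (* The initial state costs nothing and, since [0 < k], its single node already balances the term
     [th] on the left. *)
  split=> //; first by apply: light_grow_cost => //=; rewrite add0n addn0; nia.
  have [?|cl] := @light_growP E ns th k (single v) isT kn; [by left|right; split=> //].
  exists xs; split=> //; first by move=> x /xsO /OT.
  apply: leq_trans kO _; apply: uniq_leq_size; first exact: grown_uniq gO.
  move=> x /cov[y]; rewrite inE => /orP[/eqP->|yxs] xy; apply/mem_cover; last by right; exists y.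
  (* The component of the root already lies in the closed tree, so [size xs] paths suffice for
     [size xs + 1] components. *)
  by left; apply: (light_comp_min cl) xy; apply: (grown_root gs0).
have szn : size xs <= size ns.
  apply: ltnW; apply: leq_trans szx _.
  exact: uniq_leq_size (grown_uniq gO) (grown_sub Ens vn gO).
have [kr ch] := rounds Esym Ens vn kn sT TD inv szn.
exists (run E ns th k T v).
  apply/flatten_mapP; exists v => //; apply/flatten_mapP; exists D => //.
  by apply/mapP; exists th.
rewrite /run foldl_const -/s0; split=> //.
apply: (@sqrt_bound th k (size xs) L D c) => //.
  (* The weight [c] is among the values tried for [th] and exceeds the largest admissible one, so it
     is not admissible. *)
  move=> /heavy[thc [e eE ec]]; rewrite ltnNge; apply/negP=> cL.
  suff /thmax/(_ cL) : c \in 0 :: [seq e.2.2 | e <- E] by rewrite leqNgt thc.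
  by rewrite inE; apply/orP; right; apply/mapP; exists e.
apply: leq_trans ch _; rewrite add0n leq_add2r leq_mul2l; lia.
Qed.

Lemma candidates_grown s : s \in candidates E ns k S -> exists2 v, v \in ns & grown E v s.
Proof.
case/flatten_mapP=> v vn /flatten_mapP[D _ /mapP[th _ ->]]; exists v => //.
have [sT0 _ _] := dijkstraP S Ens vn.
by apply: run_grown => //; apply: spt_within.
Qed.

Lemma solveP v sO : v \in ns -> grown E v sO -> k <= size sO.1 -> sO.2.2 <= S ->
  exists v' s, [/\ v' \in ns, grown E v' s, solve E ns k S = (s.1, s.2.1), k <= size s.1 &
    s.2.2 * s.2.2 <= 4 * k * (sO.2.2 * sO.2.2)].
Proof.
move=> vn gO kO OS; have [s sC [ks sb]] := good_run vn gO kO OS.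
rewrite /solve; set l := [seq _ | _ <- _ & _].
have sl : (s, s.2.2) \in l.
  by apply/mapP; exists s; rewrite // mem_filter ks.
have [c Ec] := argmin_cons sl.
have cl : c \in argmin l by rewrite Ec mem_head.
have [_ /mapP[s'] + E' cmin] := argmin_mem cl.
rewrite mem_filter => /andP[ks' /candidates_grown[v' v'n gs']].
exists v', s'; split=> //; first by rewrite Ec /= E'.
apply: leq_trans sb; have := cmin _ sl; rewrite E' /= => le.
exact: leq_mul.
Qed.

End Solve.

(** * Clearing denominators *)

Notation entry := (option (nat * nat)).
Notation fedge := (nat * (nat * (nat * nat)))%type.

Definition indexed A (l : seq A) : seq (nat * A) :=
  (foldl (fun st x => (st.1.+1, (st.1, x) :: st.2)) (0, [::]) l).2.

Definition fedges (M : seq (seq entry)) : seq fedge :=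
  flatten [seq [seq (ir.1, (jo.1, odflt (0, 0) jo.2)) | jo <- indexed ir.2 & isSome jo.2]
    | ir <- indexed M].

(** The weight of [r] times the product of all denominators, computed without division: the entry
    [r] contributes its numerator instead of its denominator. *)
Definition scale (R : seq fedge) (r : fedge) : nat :=
  foldl (fun b r' => b * (if (r'.1 == r.1) && (r'.2.1 == r.2.1) then r'.2.2.1 else r'.2.2.2)) 1 R.

Definition scaled (R : seq fedge) : seq edge := [seq (r.1, (r.2.1, scale R r)) | r <- R].

Definition nodes (M : seq (seq entry)) : seq nat := [seq ir.1 | ir <- indexed M].

Definition sum_weights (E : seq edge) : nat := foldl (fun b e => b + e.2.2) 0 E.

Definition kmst (x : nat * (nat * seq (seq entry))) : seq nat * seq (nat * nat) :=
  solve (scaled (fedges x.2.2)) (nodes x.2.2) x.2.1 (sum_weights (scaled (fedges x.2.2))).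

Lemma bits_leS m : bits m <= m.+1.
Proof.
apply: bits_le => //; apply: ltn_trans (ltn_expl _ (isT : 1 < 2)) _.
by rewrite ltn_exp2l.
Qed.

(** A step copies the counter from the accumulator into the list, so the increment is not bounded by
    the context alone. The prefixes are bounded directly, the counter being the length of the
    prefix. *)
Lemma polytime_indexed X A `{Enc X} `{Enc A} (l : X -> seq A) : polytime l ->
  polytime (fun x => indexed (l x)).
Proof.
move=> Pl; apply: polytime_snd.
apply: (@polytime_foldl _ _ _ _ _ _ (fun _ st x => (st.1.+1, (st.1, x) :: st.2)) _ _
  (fun x => esize (l x) + 3 + esize (l x) * (esize (l x) + esize (l x) + 2))); pt; first by pb.
move=> x l1 l2 E.
have sz (l' : seq A) : (foldl (fun st x => (st.1.+1, (st.1, x) :: st.2)) (0, [::]) l').1 = size l'.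
  by elim/last_ind: l' => // l' y IH; rewrite foldl_rcons IH size_rcons.
have l1M : esize l1 <= esize (l x) by rewrite E esize_catl.
enough (H1 : forall l' : seq A, esize l' <= esize (l x) ->
    esize (foldl (fun st x => (st.1.+1, (st.1, x) :: st.2)) (0, [::]) l').2 <=
      1 + size l' * (esize (l x) + esize (l x) + 2)).
  rewrite [foldl _ _ _]surjective_pairing esize_pair sz.
  have := H1 _ l1M; have szl1 : size l1 < esize l1 by apply: size_esize.
  have : size l1 * (esize (l x) + esize (l x) + 2) <= esize (l x) * (esize (l x) + esize (l x) + 2).
    by rewrite leq_mul2r; lia.
  have bs : esize (size l1) <= (size l1).+1 by apply: bits_leS.
  by lia.
elim/last_ind => [//|l' y IH] le.
rewrite foldl_rcons esize_cons esize_pair sz size_rcons mulSn.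
have esize_rcons : esize (rcons l' y) = (esize l' + esize y).+1.
  elim: (l') => [|z s IHs]; last by rewrite rcons_cons !esize_cons IHs; lia.
  by rewrite /= esize_cons; have -> : esize ([::] : seq A) = 1 by []; lia.
have szl : size l' < esize l' by apply: size_esize.
have bs : esize (size l') <= (size l').+1 by apply: bits_leS.
have := IH (ltac:(lia)); lia.
Qed.

Lemma polytime_fedges : polytime (fun M : seq (seq entry) => fedges M).
Proof.
apply: polytime_flatten; apply: polytime_map; last by apply: polytime_indexed; pt.
apply: polytime_map; first by pt; apply: polytime_option; pt.
by apply: polytime_filter; [apply: polytime_isSome; pt|apply: polytime_indexed; pt].
Qed.

(** Multiplication adds bit sizes, so the product over all entries remains of size linear in the sum
    of their sizes, even though its value may be exponential. *)
Lemma polytime_scaled : polytime (fun R : seq fedge => scaled R).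
Proof.
apply: polytime_map; last by pt.
pt; rewrite /scale.
apply: (@polytime_foldl_add (seq fedge * fedge) nat fedge _ _ _ (fun z b r' => b *
  (if (r'.1 == z.2.1) && (r'.2.1 == z.2.2.1) then r'.2.2.1 else r'.2.2.2)) fst (fun _ => 1) (fun z
    => esize z.1)).
- by pt; apply: polytime_if; pt.
- by pt.
- by pt.
- by pb.
move=> z b [x [y [p q]]] le; rewrite !esize_bits; apply: leq_trans (bits_mul _ _) _.
rewrite leq_add2l; apply: leq_trans _ le; rewrite !esize_pair !esize_bits.
by case: ifP => _ /=; lia.
Qed.

Lemma polytime_sum_weights : polytime (fun E : seq edge => sum_weights E).
Proof.
apply: (@polytime_foldl_add _ _ _ _ _ _ (fun _ b e => b + e.2.2) _ _ (fun z => esize z)); pt.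
- by pb.
move=> z b [x [y w]] le; rewrite !esize_bits; apply: leq_trans (bits_add _ _) _.
by rewrite leq_add2l; apply: leq_trans _ le; rewrite !esize_pair !esize_bits /=; lia.
Qed.

Lemma polytime_kmst : polytime kmst.
Proof.
have PE : polytime (fun x : nat * (nat * seq (seq entry)) => scaled (fedges x.2.2)).
  by apply: (polytime_comp polytime_scaled); apply: (polytime_comp polytime_fedges); pt.
apply: (polytime_comp4 polytime_solve) => //; last by apply: (polytime_comp polytime_sum_weights).
- by apply: polytime_map; [pt|apply: polytime_indexed; pt].
- by pt.
Qed.

(** * Weighted graphs *)

Section Instance.
Variables (n : nat) (G : wgraph n).

Definition frac_of (i j : 'I_n) : nat * nat :=
  (`|numq (weight G [set i; j])|%N, `|denq (weight G [set i; j])|%N).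

Definition entry_of (i j : 'I_n) : entry :=
  if [set i; j] \in edges G then Some (frac_of i j) else None.

Definition matrix_of : seq (seq entry) := [seq [seq entry_of i j | j <- enum 'I_n] | i <- enum
  'I_n].

Lemma enc_seq_map A B `{Enc B} (f : A -> B) (e : A -> data) (l : seq A) :
  (forall a, enc (f a) = e a) -> enc (map f l) = enc_seq e l.
Proof. by move=> fe; elim: l => //= a l IH; rewrite enc_cons fe IH. Qed.

Lemma enc_instanceE k : enc (n, (k, matrix_of)) = enc_instance G k.
Proof.
rewrite /enc_instance -(enc_seq_map (f := fun i => [seq entry_of i j | j <- enum 'I_n])) //.
move=> i; apply: enc_seq_map => j; rewrite /enc_entry /entry_of /enc_rat.
by case: ifP.
Qed.

(** Reversed because [indexed] lists its entries latest first. *)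
Definition ords : seq 'I_n := rev (enum 'I_n).

Lemma mem_ords i : i \in ords. Proof. by rewrite mem_rev mem_enum. Qed.

Lemma uniq_ords : uniq ords. Proof. by rewrite rev_uniq enum_uniq. Qed.

Lemma indexedE A (l : seq A) : indexed l = rev (zip (iota 0 (size l)) l).
Proof.
rewrite /indexed.
suff -> : foldl (fun st x => (st.1.+1, (st.1, x) :: st.2)) (0, [::]) l =
  (size l, rev (zip (iota 0 (size l)) l)) by [].
elim/last_ind: l => // l y IH.
rewrite foldl_rcons IH /= size_rcons -addn1 iotaD -(cats1 l y).
by rewrite zip_cat ?size_iota // rev_cat.
Qed.

Lemma indexed_enum A (f : 'I_n -> A) :
  indexed [seq f i | i <- enum 'I_n] = [seq (val i, f i) | i <- ords].
Proof.
rewrite indexedE size_map size_enum_ord -val_enum_ord /ords map_rev; congr rev.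
by elim: (enum _) => //= i l ->.
Qed.

Lemma nodesE : nodes matrix_of = [seq val i | i <- ords].
Proof. by rewrite /nodes /matrix_of indexed_enum -map_comp. Qed.

Definition fedge_of (i j : 'I_n) : fedge := (val i, (val j, frac_of i j)).

Lemma fedgesE : fedges matrix_of =
  [seq fedge_of i j | i <- ords, j <- [seq j <- ords | [set i; j] \in edges G]].
Proof.
rewrite /fedges /matrix_of indexed_enum -map_comp; congr flatten; apply: eq_map => i /=.
rewrite indexed_enum filter_map -map_comp /preim /=.
rewrite (@eq_filter _ _ (fun j => [set i; j] \in edges G)); last first.
  by move=> j; rewrite /entry_of /=; case: ifP.
apply/eq_in_map => j; rewrite mem_filter => /andP[ij _].
by rewrite /fedge_of /entry_of /= ij.
Qed.

Local Notation R := (fedges matrix_of).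

Lemma fedgesP r :
  reflect (exists i j, [set i; j] \in edges G /\ r = fedge_of i j) (r \in R).
Proof.
rewrite fedgesE; apply: (iffP allpairsPdep) => [[i [j [_ + ->]]]|[i [j [ij ->]]]].
  by rewrite mem_filter => /andP[ij _]; exists i, j.
by exists i, j; rewrite mem_ords mem_filter ij mem_ords.
Qed.

Lemma fedge_of_inj i j i' j' : fedge_of i j = fedge_of i' j' -> i = i' /\ j = j'.
Proof. by case=> /val_inj-> /val_inj->. Qed.

Lemma uniq_fedges : uniq R.
Proof.
rewrite fedgesE; apply: allpairs_uniq_dep; first exact: uniq_ords.
  by move=> i _; apply/filter_uniq/uniq_ords.
by move=> [i j] [i' j'] _ _ /= /fedge_of_inj[<- <-].
Qed.

Definition denom : nat := \prod_(r <- R) r.2.2.2.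

Definition wt (i j : 'I_n) : nat := scale R (fedge_of i j).

Lemma denom_gt0 : 0 < denom.
Proof.
rewrite /denom big_seq; apply: prodn_cond_gt0 => r /fedgesP[i [j [_ ->]]] /=.
by rewrite absz_gt0 denq_neq0.
Qed.

Lemma scaleE r : r \in R -> scale R r = r.2.2.1 * \prod_(r' <- R | r' != r) r'.2.2.2.
Proof.
move=> rR.
have -> : scale R r = \prod_(r' <- R) (if r' == r then r'.2.2.1 else r'.2.2.2).
  rewrite big_seq /scale.
  have H (l : seq fedge) b : {subset l <= R} ->
    foldl (fun b r' => b * (if (r'.1 == r.1) && (r'.2.1 == r.2.1) then r'.2.2.1 else r'.2.2.2)) b
      l =
    b * \prod_(r' <- l | r' \in R) (if r' == r then r'.2.2.1 else r'.2.2.2).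
    elim: l b => [|y l IH] b lR /=; first by rewrite big_nil muln1.
    have yR : y \in R by apply: lR; rewrite mem_head.
    rewrite IH => [|x xl]; last by apply: lR; rewrite inE xl orbT.
    rewrite big_cons yR mulnA; congr (_ * _ * _).
    (* Within the list of edges of [G] the two ends determine the fraction, so comparing ends
       amounts to comparing entries. *)
    suff -> : (y.1 == r.1) && (y.2.1 == r.2.1) = (y == r) by [].
    have /fedgesP[i [j [_ ->]]] := yR; have /fedgesP[i' [j' [_ ->]]] := rR.
    apply/andP/eqP => [[/eqP /= /val_inj-> /eqP /= /val_inj-> //]|/fedge_of_inj[-> ->]].
    by rewrite !eqxx.
  by rewrite H // mul1n.
rewrite (bigD1_seq r) //=; last exact: uniq_fedges.
by rewrite eqxx; congr (_ * _); apply: eq_bigr => r' /negPf->.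
Qed.

Lemma wtE i j : [set i; j] \in edges G ->
  ((wt i j)%:R = denom%:R * weight G [set i; j] :> rat)%R.
Proof.
move=> ij; have rR : fedge_of i j \in R by apply/fedgesP; exists i, j.
rewrite /wt scaleE // /denom (bigD1_seq (fedge_of i j)) //=; last exact: uniq_fedges.
set P := \prod_(_ <- _ | _) _.
(* Nonnegativity makes the numerator equal to its absolute value, the only part of it present in the
   encoding. *)
have w0 := weight_ge0 ij; set w := weight G _ in w0 *.
have n0 : (0 <= numq w)%R by rewrite numq_ge0.
have an : ((absz (numq w))%:R = (numq w)%:~R :> rat)%R by rewrite -[in RHS](gez0_abs n0).
have ad : ((absz (denq w))%:R = (denq w)%:~R :> rat)%R by rewrite -[in RHS](absz_denq w).
by rewrite !natrM an ad numqE -mulrA mulrC.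
Qed.

Local Notation E := (scaled (fedges matrix_of)).
Local Notation ns := (nodes matrix_of).

Lemma scaledP e : reflect (exists i j, [set i; j] \in edges G /\ e = (val i, (val j,
  wt i j))) (e \in E).
Proof.
apply: (iffP mapP) => [[r /fedgesP[i [j [ij ->]]] ->]|[i [j [ij ->]]]].
  by exists i, j.
by exists (fedge_of i j) => //; apply/fedgesP; exists i, j.
Qed.

Lemma wt_sym i j : [set i; j] \in edges G -> wt i j = wt j i.
Proof.
move=> ij; apply/eqP; rewrite -(eqr_nat rat) wtE // wtE 1?setUC //.
Qed.

Lemma scaled_sym x y w : (x, (y, w)) \in E -> (y, (x, w)) \in E.
Proof.
case/scaledP=> i [j [ij [-> -> ->]]]; apply/scaledP; exists j, i.
by rewrite setUC; split=> //; rewrite wt_sym.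
Qed.

Lemma mem_nodes (i : 'I_n) : val i \in ns.
Proof. by rewrite nodesE map_f // mem_ords. Qed.

Lemma scaled_nodes (e : edge) : e \in E -> e.1 \in ns.
Proof. by case/scaledP=> i [j [_ ->]]; exact: mem_nodes. Qed.

Lemma size_nodes : size ns = n.
Proof. by rewrite nodesE size_map size_rev size_enum_ord. Qed.

End Instance.

(** * Trees in the graph as grown states *)

Section Trees.
Variables (n : nat) (G : wgraph n).
Implicit Types (x y u v : 'I_n) (V : {set 'I_n}) (F : {set {set 'I_n}}).

Lemma adj_sym F : symmetric (adj F).
Proof. by move=> u v; rewrite /adj setUC. Qed.

Lemma adj_connect F F' u v : F \subset F' -> connect (adj F) u v -> connect (adj F') u v.
Proof.
move=> /subsetP FF'; apply: connect_sub => a b /FF' ab; exact: connect1.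
Qed.

Lemma tree_single v : is_tree_in G [set v] set0.
Proof.
split; first exact: sub0set.
- by move=> e; rewrite inE.
- by apply/set0Pn; exists v; rewrite inE.
- by move=> a b; rewrite !inE => /eqP-> /eqP->; apply: connect0.
case=> // a p; rewrite /ucycle /= => /andP[].
by case: p => [|b p] /=; rewrite /adj inE.
Qed.

(** The new node [x] is a leaf with [y] as its only neighbour. A cycle of length at least 3 through
    [x], rotated to start there, would have two distinct neighbours of [x] as its second and last
    nodes. *)
Lemma acyclic_attach V F x y : (forall e, e \in F -> e \subset V) -> x \notin V -> y \in V ->
  acyclic F -> acyclic ([set x; y] |: F).
Proof.
move=> FV xV yV acF c /andP[cyc uc].
have adjx a : a != x -> adj ([set x; y] |: F) x a -> a = y.
  move=> ax; rewrite /adj in_setU1 => /orP[/eqP/setP/(_ a)|/FV/subsetP/(_ x)].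
    by rewrite !inE (negPf ax) eqxx /= => /esym/eqP.
  by rewrite !inE eqxx (negPf xV) => /(_ isT).
case: (boolP (x \in c)) => [xc|xc]; last first.
  apply: acF; rewrite /ucycle uc andbT.
  have sub : {in c &, subrel (adj ([set x; y] |: F)) (adj F)}.
    move=> a b ac bc; rewrite /adj in_setU1 => /orP[/eqP E|//].
    have : x \in [set a; b] by rewrite E !inE eqxx.
    by rewrite !inE => /orP[] /eqP Ex; rewrite Ex ?ac ?bc in xc.
  by apply: (sub_in_cycle sub) cyc; apply/allP.
have [i p Ep] := rot_to xc.
rewrite -(rot_cycle i) Ep in cyc; rewrite -(rot_uniq i) Ep in uc; rewrite -(size_rot i) Ep.
case: p {Ep} cyc uc => [//|a p]; elim/last_ind: p => [//|p b _].
rewrite /= rcons_path last_rcons => /and3P[xa _ bx].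
rewrite inE !mem_rcons !inE !negb_or => /and3P[/and3P[ax bx' _] /andP[ab _] _].
rewrite eq_sym in ax.
case/negP: ab; rewrite (adjx a ax xa) (adjx b _ _) // 1?eq_sym //.
by rewrite adj_sym.
Qed.

Lemma tree_attach V F x y : is_tree_in G V F -> [set x; y] \in edges G -> x \notin V -> y \in V ->
  is_tree_in G (x |: V) ([set x; y] |: F).
Proof.
move=> [FE FV V0 con ac] xyE xV yV; split.
- by rewrite subUset sub1set xyE.
- move=> e; rewrite in_setU1 => /orP[/eqP->|/FV eV].
    by apply/subsetP => z; rewrite !inE => /orP[->//|/eqP->]; rewrite yV orbT.
  by apply: subset_trans eV _; apply: subsetUr.
- by apply/set0Pn; exists x; rewrite !inE eqxx.
- set F' := _ |: F.
  have conF' a : a \in x |: V -> connect (adj F') y a.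
    rewrite in_setU1 => /orP[/eqP->|aV].
      by apply: connect1; rewrite adj_sym /adj /F' !inE eqxx.
    by apply: (@adj_connect F); [exact: subsetUr|exact: con].
  move=> a b /conF' ya /conF' yb; apply: connect_trans yb.
  by rewrite (sym_connect_sym (@adj_sym F')).
- exact: acyclic_attach FV xV yV ac.
Qed.

Local Notation E := (scaled (fedges (matrix_of G))).
Local Notation ns := (nodes (matrix_of G)).
Local Notation Q := (denom G).
Local Notation pair_val := (fun e : 'I_n * 'I_n => (val e.1, val e.2)).

Lemma tree_of_grown v s : grown E (val v) s ->
  exists (vs : seq 'I_n) (es : seq ('I_n * 'I_n)),
    let F := [set:: [seq [set e.1; e.2] | e <- es]] in
    [/\ s.1 = map val vs, s.2.1 = map pair_val es, is_tree_in G [set x in vs] F &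
      (Q%:R * tree_weight G F = (s.2.2)%:R)%R].
Proof.
elim=> [|{}s e _ [vs [es [Es1 Es2 tree W]]] eE ys xs].
  exists [:: v], [::]; split=> //=.
    have -> : [set x in [:: v]] = [set v] by apply/setP => z; rewrite !inE.
    have -> : [set:: [::]] = set0 :> {set {set 'I_n}} by apply/setP => z; rewrite !inE.
    exact: tree_single.
  have -> : [set:: [::]] = set0 :> {set {set 'I_n}} by apply/setP => z; rewrite !inE.
  by rewrite /tree_weight big_set0 mulr0.
have [x [y [xyE Ee]]] := scaledP G e eE; subst e; rewrite /= in ys xs.
rewrite Es1 mem_map in ys; last exact: val_inj.
rewrite Es1 mem_map in xs; last exact: val_inj.
exists (x :: vs), ((x, y) :: es) => /=.
set F := [set:: [seq _ | _ <- es]] in tree W *.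
have EF : [set:: [set x; y] :: [seq [set e.1; e.2] | e <- es]] = [set x; y] |: F.
  by apply/setP => z; rewrite !inE.
have EV : [set z in x :: vs] = x |: [set z in vs] by apply/setP => z; rewrite !inE.
split.
- by rewrite Es1.
- by rewrite Es2.
- by rewrite EF EV; apply: tree_attach; rewrite ?inE.
rewrite EF /tree_weight big_setU1 /=; last first.
  have [_ FV _ _ _] := tree; apply/negP=> /FV/subsetP/(_ x).
  by rewrite !inE eqxx (negPf xs) => /(_ isT).
by rewrite mulrDr W -wtE // natrD addrC.
Qed.

Lemma crossing V F (A : {set 'I_n}) u v : connected_on V F -> u \in V -> v \in V ->
  u \in A -> v \notin A ->
  exists a b, [/\ a \in A, b \notin A & [set b; a] \in F].
Proof.
move=> con uV vV uA vA.
case: (boolP [exists a, exists b, [&& a \in A, b \notin A & [set b; a] \in F]]).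
  by case/existsP=> a /existsP[b /and3P[]]; exists a, b.
move=> H; case/negP: vA; have /connectP[p + ->] := con u v uV vV.
elim: p u uA {uV} => [//|b p IH] a aA /= /andP[ab pp]; apply: IH pp.
apply: contraNT H => bA; apply/existsP; exists a; apply/existsP; exists b.
by rewrite aA bA /= setUC.
Qed.

(** Starting from any node of [V], connectivity provides an edge of [F] leaving the current node set
    until [V] is exhausted. The edges used form a subset of [F], and nonnegative weights give the
    inequality. *)
Lemma grown_of_tree V F : is_tree_in G V F ->
  exists v s, [/\ grown E (val v) s, size s.1 = #|V| & ((s.2.2)%:R <= Q%:R * tree_weight G F)%R].
Proof.
move=> [FE FV /set0Pn[v vV] con _].
have V0 : 0 < #|V| by rewrite card_gt0; apply/set0Pn; exists v.
have H m : m < #|V| -> exists s (vs : seq 'I_n) F',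
  [/\ grown E (val v) s, s.1 = map val vs /\ size vs = m.+1, v \in vs /\ {subset vs <= V},
      F' \subset F /\ (forall e, e \in F' -> e \subset [set x in vs]) &
      ((s.2.2)%:R = Q%:R * tree_weight G F')%R].
  elim: m => [_|m IH lt].
    exists (single v), [:: v], set0; split=> //; first exact: grown_single.
    - by split; [exact: mem_head|move=> x; rewrite inE => /eqP->].
    - by rewrite sub0set; split=> // e; rewrite inE.
    - by rewrite /tree_weight big_set0 mulr0.
  have [s [vs [F' [gs [Es szs] [vvs vsV] [F'F F'vs] W]]]] := IH (ltnW lt).
  have /subsetPn[u uV uvs] : ~~ (V \subset [set x in vs]).
    apply: contraL lt => /subset_leq_card le; rewrite -leqNgt (leq_trans le) // -szs.
    by rewrite cardsE card_size.
  have [|a [b [avs bvs baF]]] := crossing con vV uV _ uvs; first by rewrite inE.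
  have baE : [set b; a] \in edges G by apply: (subsetP FE).
  rewrite !inE in avs bvs.
  exists (attach s (val b, (val a, wt G b a))), (b :: vs), ([set b; a] |: F').
  have baF' : [set b; a] \notin F'.
    by apply/negP=> /F'vs/subsetP/(_ b); rewrite !inE eqxx (negPf bvs) => /(_ isT).
  split.
  - apply: grown_attach => //=; first by apply/scaledP; exists b, a.
      by rewrite Es map_f.
    by rewrite Es mem_map //; exact: val_inj.
  - by rewrite /= Es szs.
  - split; first by rewrite inE vvs orbT.
    move=> x; rewrite inE => /orP[/eqP->|/vsV//].
    by have /subsetP := FV _ baF; apply; rewrite !inE eqxx.
  - split; first by rewrite subUset sub1set baF.
    move=> e; rewrite in_setU1 => /orP[/eqP->|/F'vs/subsetP sub]; apply/subsetP => z.
      by rewrite !inE => /orP[->//|/eqP->]; rewrite avs orbT.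
    by move/sub; rewrite !inE => ->; rewrite orbT.
  - by rewrite /tree_weight big_setU1 //= mulrDr -wtE // -[X in (_ + X)%R]W natrD addrC.
have [|s [vs [F' [gs [Es szs] _ [F'F _] W]]]] := H #|V|.-1; first by rewrite prednK.
exists v, s; split=> //; first by rewrite Es size_map szs prednK.
rewrite W ler_wpM2l ?ler0n // /tree_weight [leRHS](big_setID F') /= (setIidPr F'F).
rewrite lerDl sumr_ge0 // => e; rewrite inE => /andP[_ /(subsetP FE)].
exact: weight_ge0.
Qed.

(** Each attached edge leads to a different node, so the cost is at most the total weight of the
    edges leading to nodes of the tree. Hence the sum of all weights is a cap [S] that excludes no
    grown tree. *)
Lemma grown_le_sum v s (E0 : seq edge) : grown E0 v s -> s.2.2 <= sum_weights E0.
Proof.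
have -> : sum_weights E0 = \sum_(e <- E0) e.2.2.
  have H (l : seq edge) b : foldl (fun b e => b + e.2.2) b l = b + \sum_(e <- l) e.2.2.
    elim: l b => [|e l IH] b /=; first by rewrite big_nil addn0.
    by rewrite IH big_cons addnA.
  by rewrite /sum_weights H add0n.
move=> gs; apply: (@leq_trans (\sum_(e <- E0 | e.1 \in s.1) e.2.2)); last first.
  by rewrite [leqRHS](bigID (fun e : edge => e.1 \in s.1)) leq_addr.
elim: gs => // {}s e _ IH eE _ es /=.
rewrite (bigID (fun e : edge => e.1 \in s.1)) /=; apply: leq_add.
  apply: leq_trans IH _; apply: eq_leq; apply: eq_bigl => e'.
  by rewrite inE andbC; case: (e'.1 \in s.1) => //=; rewrite orbT.
rewrite (big_rem e) //= inE eqxx es; exact: leq_addr.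
Qed.

End Trees.

(** * From squares to square roots *)

Lemma le_sqrt_bound (R : realType) (k : nat) (a b : R) : (0 <= b)%R ->
  (a ^+ 2 <= 4 * k%:R * b ^+ 2)%R -> (a <= 2 * Num.sqrt k%:R * b)%R.
Proof.
move=> b0 ab; apply: le_trans (ler_norm _) _.
have c0 : (0 <= 2 * Num.sqrt k%:R * b)%R.
  by apply: mulr_ge0 => //; apply: mulr_ge0; rewrite ?sqrtr_ge0 ?ler0n.
rewrite -ler_sqr ?nnegrE // real_normK ?num_real // !exprMn sqr_sqrtr ?ler0n //.
by rewrite -natrX.
Qed.

Lemma ratr_sqrt_bound (R : realType) (k : nat) (a b : rat) : (0 <= b)%R ->
  (a ^+ 2 <= 4 * k%:R * b ^+ 2)%R -> (ratr a <= 2 * Num.sqrt k%:R * ratr b :> R)%R.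
Proof.
move=> b0 ab; apply: le_sqrt_bound; first by rewrite ler0q.
have -> : (ratr a ^+ 2 = ratr (a ^+ 2) :> R)%R by rewrite rmorphXn.
have -> : (4 * k%:R * ratr b ^+ 2 = ratr (4 * k%:R * b ^+ 2) :> R)%R.
  by rewrite [in RHS]rmorphM rmorphM /= !ratr_nat rmorphXn.
by rewrite ler_rat.
Qed.

Lemma kmstP n (G : wgraph n) k Vopt Fopt : 0 < k <= n -> is_min_tree G k Vopt Fopt ->
  exists V F, [/\ represents (enc (kmst (n, (k, matrix_of G)))) V F, is_tree_in G V F, k <= #|V| &
    (tree_weight G F ^+ 2 <= 4 * k%:R * tree_weight G Fopt ^+ 2)%R].
Proof.
move=> /andP[k0 kn] [tree cardV _].
have [v [sO [gO szO leO]]] := grown_of_tree tree.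
have kns : k <= size (nodes (matrix_of G)) by rewrite size_nodes.
rewrite /kmst /=.
have [||v' [s [v'ns gs -> ks cost]]] :=
  solveP (S := sum_weights (scaled (fedges (matrix_of G)))) (@scaled_sym n G) (@scaled_nodes n G)
    k0 kns (mem_nodes G v) gO.
- by rewrite szO cardV.
- exact: grown_le_sum gO.
move: v'ns; rewrite nodesE => /mapP[i _ Ev'].
have [vs [es [Es1 Es2 treeF W]]] : exists (vs : seq 'I_n) (es : seq ('I_n * 'I_n)),
    let F := [set:: [seq [set e.1; e.2] | e <- es]] in
    [/\ s.1 = map val vs, s.2.1 = [seq (val e.1, val e.2) | e <- es], is_tree_in G [set x in vs] F &
      ((denom G)%:R * tree_weight G F = (s.2.2)%:R)%R].
  by apply: (@tree_of_grown n G i); rewrite -Ev'.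
exists [set x in vs], [set:: [seq [set e.1; e.2] | e <- es]]; split=> //.
- exists vs, es; split=> //; rewrite Es1 Es2.
  by congr Pair; apply: enc_seq_map.
- rewrite cardsE; move: (grown_uniq gs) ks; rewrite Es1 size_map (map_inj_uniq val_inj).
  by move=> /card_uniqP->.
have Q0 : (0 < (denom G)%:R :> rat)%R by rewrite ltr0n denom_gt0.
have Q2 : (0 < (denom G)%:R ^+ 2 :> rat)%R by rewrite exprn_gt0.
(* Multiplying by the square of the common denominator reduces the claim to the inequality between
   natural numbers given by [solveP]. *)
rewrite -(ler_pM2l Q2) -exprMn W [leRHS]mulrCA -exprMn.
apply: (@le_trans _ _ (4 * k%:R * (sO.2.2)%:R ^+ 2)%R).
  by rewrite -!natrX -!natrM ler_nat -!mulnn.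
by rewrite ler_wpM2l ?mulr_ge0 ?ler0n // ler_sqr ?nnegrE ?ler0n // (le_trans _ leO) ?ler0n.
Qed.

Local Open Scope ring_scope.

Theorem theorem1p2 :
  exists (p : cmd) (q : {poly nat}),
    forall (n : nat) (G : wgraph n) (k : nat),
      (0 < k <= n)%N ->
      exists (out : data) (t : nat),
        [/\ runs p (enc_instance G k) out t,
            (t <= q.[dsize (enc_instance G k)])%N &
            forall (Vopt : {set 'I_n}) (Fopt : {set {set 'I_n}}),
              is_min_tree G k Vopt Fopt ->
              exists (V : {set 'I_n}) (F : {set {set 'I_n}}),
                [/\ represents out V F,
                    is_tree_in G V F,
                    (k <= #|V|)%N &
                    forall R : realType,
                      (ratr (tree_weight G F) : R)
                        <= 2 * Num.sqrt k%:R * ratr (tree_weight G Fopt)]].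
Proof.
have [p [N [g [_ [h [q hq] gh] Cp]]]] := polytime_kmst.
exists p, q => n G k kn.
have [|s [t [ex o _ tb]]] := Cp (init_store (enc_instance G k)) (n, (k, matrix_of G)).
  by rewrite enc_instanceE.
exists (enc (kmst (n, (k, matrix_of G)))), t; split.
- by exists s.
- by apply: leq_trans tb _; apply: leq_trans (gh _) _; rewrite hq /esize enc_instanceE.
move=> Vopt Fopt opt; have [V [F [rep tree kV W]]] := kmstP kn opt.
(* The squared bound over the rationals does not mention [R], so the same tree serves every real
   field. *)
exists V, F; split=> // R; apply: ratr_sqrt_bound => //.
have [[FE _ _ _ _] _ _] := opt.
by apply: sumr_ge0 => e /(subsetP FE); apply: weight_ge0.
Qed.
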